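(* For every $n\ge 1$, the homogeneous component $\mathsf{D}_n$ of the series $\mathsf{D}=(1+\mathsf{U})\vee(1+\mathsf{V})$, seen as an element of the symmetric group ring of $\mathfrak{S}_n$, is (up to multiplication by a nonzero scalar) a Lie idempotent, and satisfies $$\mathsf{D}_n\cdot\mathsf{D}_n=n\,\mathbf{ca}_{n-1}\,\mathsf{D}_n .$$
   Context: **Narayana polynomials.** For $n\ge1$ let $\mathrm{Lnr}_n$ be the chain with $n$ vertices rooted at its bottom vertex. A closed flow on $\mathrm{Lnr}_n$ is a set $O$ of vertices (outputs) and a function $m$ from vertices to $\mathbb{N}$ vanishing on $O$, such that the rates $r(v)=m(v)-[v\in O]+r(\text{child of }v)$ (the last term being $0$ for the top vertex) are all $\ge0$ and the rate at the root is $0$. Then $\mathbf{ca}_n=\sum b^{|O|}\in\mathbb{Z}[b]$, summed over closed flows on $\mathrm{Lnr}_n$ (the Narayana polynomials: $\mathbf{ca}_1=1$, $\mathbf{ca}_2=1+b$, $\mathbf{ca}_3=1+3b+b^2$, …), and $\mathbf{ca}_0=1$. **Trees.** A planar binary tree is either the trivial tree $1=|$ or $x\vee y$, obtained by gluing planar binary trees $x$ (left) and $y$ (right) on a new root vertex; the degree is the number of inner vertices; $\vee$ is extended bilinearly to series. The canopy of a tree of degree $n$ is the word of length $n-1$ in letters $\mathtt{p},\mathtt{m}$ (written $+,-$ in the paper) with one letter for each leaf except the leftmost and the rightmost, from left to right: $\mathtt{m}$ if the leaf is a left child, $\mathtt{p}$ if it is a right child. The right-completed canopy appends $\mathtt{p}$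 at the end; the left-completed canopy adds $\mathtt{m}$ at the beginning. **Series.** With $\emptyset$ the empty word, let $\mathbf{P}=\sum_{k\ge1}\mathbf{ca}_k\mathtt{p}^k$, $\mathbf{N}=\sum_{k\ge1}(-1)^k\mathbf{ca}_k\mathtt{m}^k$, $\mathbf{T}=\sum_{k\ge0}b^k(\mathbf{P}\mathbf{N})^k$, $\mathbf{U}=(\emptyset+b\mathbf{N})\mathbf{T}\mathbf{P}$, $\mathbf{V}=\mathbf{N}\mathbf{T}(\emptyset+b\mathbf{P})$ (noncommutative power series). $\mathsf{U}$ (resp. $\mathsf{V}$) is the series of planar binary trees of degree $\ge1$ in which the coefficient of a tree is the coefficient in $\mathbf{U}$ (resp. $\mathbf{V}$) of its right-completed (resp. left-completed) canopy. **Identification with group ring elements.** The coefficient of a tree in $\mathsf{D}$ depends only on its canopy $\epsilon$; call it $d_\epsilon$. It equals $(-1)^{\#\mathtt{m}}\,b^{j}\prod\mathbf{ca}_{\ell}$, the product over the lengths $\ell$ of the maximal blocks of equal letters of $\epsilon$, where $j$ is the number of maximal $\mathtt{m}$-blocks of $\epsilon$ other than the last (rightmost) block. Via the embeddings of noncommutative symmetric functions (ribbon Schur functions indexed by words $\epsilon\in\{\mathtt{p},\mathtt{m}\}^{n-1}$) in the free dendriform algebra (ribbon $\epsilon\mapsto$ sum of trees with canopy $\epsilon$) and in $\bigoplus_n\mathbb{Q}[\mathfrak{S}_n]$ (ribbon $\epsilon\mapsto$ sum of permutations $\sigma$ such that $\sigma(i)>\sigma(i+1)$ iff $\epsilon_i=\mathtt{m}$),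 $\mathsf{D}_n$ is the element $\sum_{\sigma\in\mathfrak{S}_n}d_{\epsilon(\sigma)}\,\sigma$ of $\mathbb{Q}[b][\mathfrak{S}_n]$, where $\epsilon(\sigma)$ is the descent word of $\sigma$. **Lie idempotents.** With product $(\sigma\tau)(i)=\sigma(\tau(i))$ and $\sigma$ identified with the word $x_{\sigma(1)}\cdots x_{\sigma(n)}$, let $\mathrm{Lie}(n)$ be the subspace of multilinear Lie elements in $x_1,\dots,x_n$ (coefficients extended to $\mathbb{Q}(b)$). A Lie idempotent is an idempotent $\theta$ such that $x\mapsto x\theta$ is a projector onto $\mathrm{Lie}(n)$. *)

(* Defs.v *)
From HB Require Import structures.
From mathcomp Require Import all_boot all_order all_algebra all_fingroup.
From mathcomp Require Import zify.
From mathcomp.multinomials Require Import monalg.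

Set Implicit Arguments.
Unset Strict Implicit.
Unset Printing Implicit Defensive.

Import Order.TTheory GRing.Theory Num.Theory.
Local Open Scope ring_scope.

(* The indeterminate b is 'X. *)
Notation Qb := {poly rat}.

(* The vertices of the chain are numbered from the top: vertex 0 is the top,
   vertex n.-1 is the root and the child of vertex k.+1 is vertex k.
   [O] is the indicator of the set of outputs, [f] the list of inputs. *)
Fixpoint rate (O : seq bool) (f : seq nat) (k : nat) : int :=
  (nth 0%N f k)%:Z - (nth false O k : nat)%:Z
  + (if k is k'.+1 then rate O f k' else 0).

Definition closed_flow (n : nat) (O : seq bool) (f : seq nat) : bool :=
  [&& [forall v : 'I_n, nth false O v ==> (nth 0%N f v == 0%N)],
      [forall v : 'I_n, 0 <= rate O f v]
    & rate O f n.-1 == 0].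

(* By [closed_flow_bound] below, no closed flow is lost by bounding f by n. *)
Definition ca (n : nat) : Qb :=
  if n is 0 then 1 else
  \sum_(O : n.-tuple bool)
    \sum_(f : n.-tuple 'I_n.+1 | closed_flow n O [seq val i | i <- f])
      'X ^+ count id O.

Lemma closed_flow_bound n (O : seq bool) (f : seq nat) :
  size O = n -> size f = n -> closed_flow n O f -> all (fun i => i < n.+1)%N f.
Proof.
move=> sO sf /and3P[_ _ /eqP r0].
have rE k : rate O f k
    = \sum_(j < k.+1) ((nth 0%N f j)%:Z - (nth false O j : nat)%:Z).
  elim: k => [|k IH]; first by rewrite big_ord1 /= addr0.
  by rewrite big_ord_recr /= -IH addrC.
apply/allP => x /(nthP 0%N)[i]; rewrite sf => lin <-.
case: n sO sf r0 lin => // n sO sf; rewrite rE sumrB => /eqP.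
rewrite subr_eq0 -!(big_morph Posz PoszD (erefl _)) => /eqP[E] lin.
rewrite ltnS; apply: (@leq_trans (\sum_(j < n.+1) nth 0%N f j)).
  by rewrite (bigD1 (Ordinal lin)) //= leq_addr.
rewrite E -[X in (_ <= X)%N](card_ord n.+1) -sum1_card.
by apply: leq_sum => j _; case: nth.
Qed.

(* lp and lm are the letters p and m. *)
Definition letter := bool.
Definition lp : letter := false.
Definition lm : letter := true.

Definition ncseries := seq letter -> Qb.

Definition nc1 : ncseries := fun w => (w == [::])%:R.
Definition ncadd (f g : ncseries) : ncseries := fun w => f w + g w.
Definition ncscale (c : Qb) (f : ncseries) : ncseries := fun w => c * f w.
Definition ncmul (f g : ncseries) : ncseries := fun w =>
  \sum_(i < (size w).+1) f (take i w) * g (drop i w).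
Definition ncexp (f : ncseries) (k : nat) : ncseries := iter k (ncmul f) nc1.

(* \sum_(k >= 1) a k c^k *)
Definition powser (c : letter) (a : nat -> Qb) : ncseries := fun w =>
  if (w != [::]) && all (pred1 c) w then a (size w) else 0.

Definition serP : ncseries := powser lp ca.
Definition serN : ncseries := powser lm (fun k => (-1) ^+ k * ca k).

(* The terms of index k > size w do not contribute to the coefficient of w,
   because PN has no constant term: see [ncexp_small] below. *)
Definition serT : ncseries := fun w =>
  \sum_(k < (size w).+1) 'X ^+ k * ncexp (ncmul serP serN) k w.

Definition serU : ncseries :=
  ncmul (ncmul (ncadd nc1 (ncscale 'X serN)) serT) serP.
Definition serV : ncseries :=
  ncmul (ncmul serN serT) (ncadd nc1 (ncscale 'X serP)).

Inductive tree : Type := leaf | node of tree & tree.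

Fixpoint degree (t : tree) : nat :=
  if t is node x y then (degree x + degree y).+1 else 0.

(* The letters of all the leaves of t, from left to right; c is the letter to
   be used when t is itself a leaf. *)
Fixpoint leafword (c : letter) (t : tree) : seq letter :=
  if t is node x y then leafword lm x ++ leafword lp y else [:: c].

Definition canopy (t : tree) : seq letter :=
  let s := behead (leafword lp t) in take (size s).-1 s.

Definition right_completed (t : tree) : seq letter := rcons (canopy t) lp.
Definition left_completed (t : tree) : seq letter := lm :: canopy t.

Definition treeseries := tree -> Qb.

Definition tree1 : treeseries := fun t => (degree t == 0%N)%:R.
Definition tadd (f g : treeseries) : treeseries := fun t => f t + g t.
Definition vee (f g : treeseries) : treeseries := fun t =>
  if t is node x y then f x * g y else 0.

Definition treeU : treeseries := fun t =>
  if (0 < degree t)%N then serU (right_completed t) else 0.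
Definition treeV : treeseries := fun t =>
  if (0 < degree t)%N then serV (left_completed t) else 0.
Definition treeD : treeseries := vee (tadd tree1 treeU) (tadd tree1 treeV).

Fixpoint graft_left (t : tree) : tree :=
  if t is node x y then node (graft_left x) y else node leaf leaf.

(* A tree with a given canopy, see [canopy_tree_with_canopy]. *)
Fixpoint tree_with_canopy (w : seq letter) : tree :=
  if w is c :: w' then
    if c == lm then node leaf (tree_with_canopy w')
    else graft_left (tree_with_canopy w')
  else node leaf leaf.

(* By [treeD_canopy], this is the coefficient in treeD of every tree with
   canopy eps. *)
Definition d_coef (eps : seq letter) : Qb := treeD (tree_with_canopy eps).

Definition group_ring (R : comNzRingType) (n : nat) := {ffun 'S_n -> R}.

Definition gscale (R : comNzRingType) n (c : R) (x : group_ring R n) :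
  group_ring R n := [ffun s => c * x s].

(* The product of permutations used here is s o t, which is (t * s)%g in
   MathComp. *)
Definition gmul (R : comNzRingType) n (x y : group_ring R n) :
  group_ring R n :=
  [ffun g => \sum_(s : 'S_n) \sum_(t : 'S_n | (t * s)%g == g) x s * y t].

Definition descent_letters (s : seq nat) : seq letter :=
  if s is a :: s' then
    pairmap (fun i j => if (j < i)%N then lm else lp) a s'
  else [::].

Definition descent_word n (s : 'S_n) : seq letter :=
  descent_letters [seq val (s i) | i <- enum 'I_n].

Definition D_elt (n : nat) : group_ring Qb n := [ffun s => d_coef (descent_word s)].

Notation Kb := {fraction Qb}.

Notation free_alg K n := {malg K[{fmonom 'I_n}]}.

Definition fvar (K : fieldType) n (i : 'I_n) : free_alg K n := << fmu i >>.

Inductive Lie_element (K : fieldType) n : free_alg K n -> Prop :=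
| Lie_var i : Lie_element (fvar K i)
| Lie_zero : Lie_element 0
| Lie_add p q : Lie_element p -> Lie_element q -> Lie_element (p + q)
| Lie_scale c p : Lie_element p -> Lie_element (c *: p)
| Lie_bracket p q :
    Lie_element p -> Lie_element q -> Lie_element (p * q - q * p).

(* identifies s with the word x_(s 1) ... x_(s n) *)
Definition to_free_alg (K : fieldType) n (x : group_ring K n) : free_alg K n :=
  \sum_(s : 'S_n) x s *: \prod_(i < n) fvar K (s i).

Definition in_Lie (K : fieldType) n (x : group_ring K n) : Prop :=
  Lie_element (to_free_alg x).

Definition Lie_idempotent (K : fieldType) n (theta : group_ring K n) : Prop :=
  gmul theta theta = theta
  /\ (forall y, in_Lie y <-> exists x, y = gmul x theta).

Definition extend_scalars n (x : group_ring Qb n) : group_ring Kb n :=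
  [ffun s => tofrac (x s)].

Lemma ncexp_small (f : ncseries) k w :
  f [::] = 0 -> (size w < k)%N -> ncexp f k w = 0.
Proof.
move=> f0; elim: k w => // k IH w lwk; rewrite /ncexp iterS /ncmul.
rewrite big1 // => -[[|i] lti] _ /=; first by rewrite take0 f0 mul0r.
case: w lwk lti => // c w lwk lti.
rewrite [X in _ * X]IH ?mulr0 // size_drop subSS.
exact: leq_ltn_trans (leq_subr _ _) _.
Qed.

Lemma eq_ncmul f f' g g' :
  f =1 f' -> g =1 g' -> ncmul f g =1 ncmul f' g'.
Proof. by move=> ef eg w; apply: eq_bigr => i _; rewrite ef eg. Qed.

Lemma ncmul_cons f g c w :
  ncmul f g (c :: w) = f [::] * g (c :: w) + ncmul (fun v => f (c :: v)) g w.
Proof. by rewrite /ncmul big_ord_recl. Qed.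

Lemma ncmul_nil f g : ncmul f g [::] = f [::] * g [::].
Proof. by rewrite /ncmul big_ord1. Qed.

Lemma ncmulDl f f' g w :
  ncmul (ncadd f f') g w = ncmul f g w + ncmul f' g w.
Proof. by rewrite -big_split; apply: eq_bigr => i _; rewrite mulrDl. Qed.

Lemma ncmulDr f g g' w :
  ncmul f (ncadd g g') w = ncmul f g w + ncmul f g' w.
Proof. by rewrite -big_split; apply: eq_bigr => i _; rewrite mulrDr. Qed.

Lemma ncmulZl c f g w : ncmul (ncscale c f) g w = c * ncmul f g w.
Proof. by rewrite mulr_sumr; apply: eq_bigr => i _; rewrite mulrA. Qed.

Lemma ncmulZr c f g w : ncmul f (ncscale c g) w = c * ncmul f g w.
Proof. by rewrite mulr_sumr; apply: eq_bigr => i _; rewrite mulrCA. Qed.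

Lemma ncmulA f g h : ncmul f (ncmul g h) =1 ncmul (ncmul f g) h.
Proof.
move=> w; elim: w f g => [|c w IH] f g; first by rewrite !ncmul_nil mulrA.
rewrite !ncmul_cons ncmul_nil IH mulrDr mulrA -addrA; congr (_ + _).
rewrite -ncmulZl -ncmulDl; apply: eq_ncmul => // v.
by rewrite ncmul_cons.
Qed.

Lemma ncmul1l f : ncmul nc1 f =1 f.
Proof.
case=> [|c w]; first by rewrite ncmul_nil mul1r.
rewrite ncmul_cons mul1r /ncmul big1 ?addr0 // => i _.
by rewrite /nc1 /= mul0r.
Qed.

Lemma ncmul1r f : ncmul f nc1 =1 f.
Proof.
move=> w; elim: w f => [|c w IH] f; first by rewrite ncmul_nil mulr1.
by rewrite ncmul_cons IH /nc1 /= mulr0 add0r.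
Qed.

Definition PN := ncmul serP serN.

Lemma serT_eq : serT =1 ncadd nc1 (ncscale 'X (ncmul PN serT)).
Proof.
have PN0 : PN [::] = 0 by rewrite /PN ncmul_nil mul0r.
have TE n w : (size w < n)%N -> serT w = \sum_(k < n) 'X ^+ k * ncexp PN k w.
  move=> lwn; rewrite -(subnKC lwn) big_split_ord /= [X in _ = _ + X]big1.
    by rewrite addr0.
  move=> i _; rewrite -[ncmul PN _]/(ncexp PN (size w + i).+1).
  by rewrite ncexp_small ?mulr0 // ltnS leq_addr.
move=> w; rewrite (TE (size w).+2) // big_ord_recl expr0 mul1r.
congr (_ + _); rewrite /ncscale /ncmul.
under [in RHS]eq_bigr => i _ do
  rewrite (TE (size w).+1) ?size_drop ?ltnS ?leq_subr // mulr_sumr.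
rewrite exchange_big mulr_sumr; apply: eq_bigr => k _ /=.
rewrite exprS -mulrA; congr (_ * _).
rewrite /bump /= /ncexp /= /ncmul mulr_sumr; apply: eq_bigr => i _.
by rewrite mulrCA.
Qed.

Lemma powser_mul_head c a f x w :
  x != c -> ncmul (powser c a) f (x :: w) = 0.
Proof.
move=> xc; rewrite /ncmul big1 // => -[[|i] ?] _; first by rewrite mul0r.
by rewrite /powser /= (negbTE xc) mul0r.
Qed.

Lemma powser_mul_run c a f k w : (0 < k)%N ->
  (forall v, f (c :: v) = 0) -> head (~~ c) w != c ->
  ncmul (powser c a) f (nseq k c ++ w) = a k * f w.
Proof.
move=> k0 f0 hw; have lk : (k < (size (nseq k c ++ w)).+1)%N.
  by rewrite size_cat size_nseq; lia.
rewrite /ncmul (bigD1 (Ordinal lk)) //= take_size_cat ?size_nseq //.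
rewrite drop_size_cat ?size_nseq // /powser all_nseq size_nseq /= eqxx orbT.
case: k k0 lk => //= k _ lk; rewrite big1 ?addr0 // => -[i li] /=.
rewrite -val_eqE /= => ne; rewrite -!cat_cons -[c :: nseq k c]/(nseq k.+1 c).
have [lik|lki|e] := ltngtP i k.+1; last by rewrite e eqxx in ne.
  rewrite drop_cat size_nseq lik drop_nseq.
  by rewrite -[(k.+1 - i)%N]prednK ?subn_gt0 //= f0 mulr0.
rewrite take_cat size_nseq ltnNge (ltnW lki) /= all_cat.
case: w hw li {lk} => [|x w] /= hw li.
  by move: li; rewrite cats0 size_nseq; lia.
rewrite -[(i - k.+1)%N]prednK ?subn_gt0 //= (negbTE hw).
by rewrite !andbF mul0r.
Qed.

(* The explicit value of d_coef: [wt c k w] is the product over the blocks of the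
   word c^k w. *)
Definition blk (c : letter) k : Qb := if c then (-1) ^+ k * ca k else ca k.

Fixpoint wt (c : letter) (k : nat) (w : seq letter) : Qb :=
  if w is x :: w' then
    if x == c then wt c k.+1 w'
    else blk c k * (if c then 'X else 1) * wt x 1 w'
  else blk c k.

Definition word_wt (w : seq letter) : Qb := if w is x :: w' then wt x 1 w' else 1.

Lemma wt_cut c k u v :
  wt c k (u ++ lp :: lm :: v) = wt c k (rcons u lp) * wt lm 1 v.
Proof.
elim: u c k => [|x u IH] c k /=.
  by case: c => /=; rewrite ?mulr1 ?mulrA.
by case: eqP => _; rewrite IH // mulrA.
Qed.

Lemma word_wt_cut u v :
  word_wt (rcons u lp ++ lm :: v) = word_wt (rcons u lp) * word_wt (lm :: v).
Proof. by case: u => [|x u] /=; rewrite ?mulr1 // cat_rcons wt_cut. Qed.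

Definition serX := ncmul serT serP.
Definition serY := ncscale 'X (ncmul serN serX).

Lemma serX_eq : serX =1 ncmul serP (ncadd nc1 serY).
Proof.
move=> w; rewrite /serX (eq_ncmul serT_eq (frefl _)) ncmulDl ncmulDr.
rewrite ncmul1l ncmul1r ncmulZl ncmulZr; congr (_ + _ * _).
by rewrite /PN -!ncmulA.
Qed.

Lemma serXY_run w : forall k, (0 < k)%N ->
  (last lp w == lp -> serX (nseq k lp ++ w) = wt lp k w) /\
  (last lm w == lp -> serY (nseq k lm ++ w) = wt lm k w).
Proof.
have Xm v : serX (lm :: v) = 0 by rewrite serX_eq powser_mul_head.
have Yp v : ncadd nc1 serY (lp :: v) = 0.
  by rewrite /ncadd /serY /ncscale powser_mul_head // mulr0 addr0.
elim: w => [|[] w IH] k k0; split=> // lw.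
- rewrite serX_eq powser_mul_run //.
  by rewrite /ncadd /serY /ncscale ncmul_nil mul0r mulr0 addr0 mulr1.
- rewrite serX_eq powser_mul_run //= /ncadd add0r.
  by rewrite mulr1; have [_ /(_ lw) <-] := IH 1%N isT.
- rewrite -[_ :: w]/([:: lm] ++ w) catA -[[:: lm]]/(nseq 1 lm) -nseqD addn1.
  by have [_ /(_ lw) ->] := IH k.+1 isT.
- rewrite -[_ :: w]/([:: lp] ++ w) catA -[[:: lp]]/(nseq 1 lp) -nseqD addn1.
  by have [/(_ lw) -> _] := IH k.+1 isT.
- rewrite /serY /ncscale powser_mul_run //=.
  by have [/(_ lw) <- _] := IH 1%N isT; rewrite mulrA [X in X * _]mulrC.
Qed.

Lemma serU_wt u : serU (rcons u lp) = word_wt (rcons u lp).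
Proof.
rewrite /serU -ncmulA ncmulDl ncmul1l ncmulZl -/serX.
have Xm v : serX (lm :: v) = 0 by rewrite serX_eq powser_mul_head.
have last_u : last lp (rcons u lp) = lp by rewrite last_rcons.
have nil_u : rcons u lp != [::] by case: (u).
case: (rcons u lp) last_u nil_u => [|[] w] //= lw _.
- by rewrite Xm add0r; apply: (proj2 (@serXY_run w 1 isT)); apply/eqP.
- rewrite powser_mul_head // mulr0 addr0.
  by apply: (proj1 (@serXY_run w 1 isT)); apply/eqP.
Qed.

Definition serS := ncmul serT (ncadd nc1 (ncscale 'X serP)).
Definition serQ := ncscale 'X (ncmul serP (ncadd nc1 serV)).

Lemma serV_eq : serV =1 ncmul serN (ncadd nc1 serQ).
Proof.
have VS : serV =1 ncmul serN serS by move=> w; rewrite /serV -ncmulA.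
move=> w; rewrite VS; apply: eq_ncmul => // {}w.
rewrite /serS (eq_ncmul serT_eq (frefl _)) ncmulDl ncmul1l /ncadd.
rewrite -addrA; congr (_ + _); rewrite /serQ ncmulZl /ncscale -mulrDr.
rewrite ncmulDr ncmul1r; congr (_ * (_ + _)).
by rewrite /PN -!ncmulA; apply: eq_ncmul => // v; rewrite VS.
Qed.

Lemma serVQ_run w : forall k, (0 < k)%N ->
  serV (nseq k lm ++ w) = wt lm k w /\
  serQ (nseq k lp ++ w) = 'X * wt lp k w.
Proof.
have Vp v : ncadd nc1 serV (lp :: v) = 0.
  by rewrite /ncadd serV_eq powser_mul_head // addr0.
have Qm v : ncadd nc1 serQ (lm :: v) = 0.
  by rewrite /ncadd /serQ /ncscale powser_mul_head // mulr0 addr0.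
elim: w => [|[] w IH] k k0; split.
- rewrite serV_eq powser_mul_run //.
  by rewrite /ncadd /serQ /ncscale ncmul_nil mul0r mulr0 addr0 mulr1.
- rewrite /serQ /ncscale powser_mul_run //.
  by rewrite /ncadd serV_eq ncmul_nil mul0r addr0 mulr1.
- rewrite -[_ :: w]/([:: lm] ++ w) catA -[[:: lm]]/(nseq 1 lm) -nseqD addn1.
  by have [-> _] := IH k.+1 isT.
- rewrite /serQ /ncscale powser_mul_run //= /ncadd add0r mulr1.
  by have [<- _] := IH 1%N isT.
- rewrite serV_eq powser_mul_run //= /ncadd add0r -mulrA.
  by have [_ <-] := IH 1%N isT.
- rewrite -[_ :: w]/([:: lp] ++ w) catA -[[:: lp]]/(nseq 1 lp) -nseqD addn1.
  by have [_ ->] := IH k.+1 isT.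
Qed.

Lemma serV_wt v : serV (lm :: v) = word_wt (lm :: v).
Proof. exact: (proj1 (@serVQ_run v 1 isT)). Qed.

Lemma leafword_canopy c x y :
  leafword c (node x y) = lm :: rcons (canopy (node x y)) lp.
Proof.
suff [s e] : exists s, leafword lp (node x y) = lm :: rcons s lp.
  rewrite -[LHS]/(leafword lp (node x y)) /canopy e /= size_rcons /=.
  by rewrite -cats1 take_size_cat // cats1.
have hl : forall t, exists s, leafword lm t = lm :: s.
  elim=> [|t [s e] t' _]; first by exists [::].
  by exists (s ++ leafword lp t'); rewrite /= e.
have hr : forall t, exists s, leafword lp t = rcons s lp.
  elim=> [|t _ t' [s e]]; first by exists [::].
  by exists (leafword lm t ++ s); rewrite /= e rcons_cat.
have [[s e] [s' e']] := (hl x, hr y); exists (s ++ s').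
by rewrite /= e e' /= rcons_cat.
Qed.

Lemma canopy_node x y : canopy (node x y) =
  (if x is leaf then [::] else right_completed x)
  ++ (if y is leaf then [::] else left_completed y).
Proof.
have := leafword_canopy lp x y.
rewrite [leafword _ (node x y)]/(leafword lm x ++ leafword lp y).
rewrite /right_completed /left_completed.
case: x y => [|x1 x2] [|y1 y2] //;
  rewrite ?(leafword_canopy _ x1) ?(leafword_canopy _ y1) => -[].
- by rewrite -rcons_cons => /rcons_inj[].
- by rewrite -/(cat _ _) cats1 => /rcons_inj[] <-; rewrite cats0.
- by rewrite -/(cat _ _) -rcons_cons -rcons_cat => /rcons_inj[].
Qed.

Lemma treeD_wt t : (0 < degree t)%N -> treeD t = word_wt (canopy t).
Proof.
case: t => // x y _; rewrite canopy_node /treeD /vee /tadd /tree1 /treeU /treeV.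
case: x y => [|x1 x2] [|y1 y2] /=; rewrite ?addr0 ?add0r ?mulr1 ?mul1r //.
- exact: serV_wt.
- by rewrite cats0 serU_wt.
- by rewrite serU_wt serV_wt word_wt_cut.
Qed.

Lemma leafword_graft_left t :
  exists2 s, leafword lm t = lm :: s & leafword lm (graft_left t) = [:: lm, lp & s].
Proof.
elim: t => [|x [s e1 e2] y _]; first by exists [::].
by exists (s ++ leafword lp y); rewrite /= ?e1 ?e2.
Qed.

Lemma canopy_tree_with_canopy w : canopy (tree_with_canopy w) = w.
Proof.
suff : forall c, leafword c (tree_with_canopy w) = lm :: rcons w lp.
  move=> /(_ lp) e; rewrite /canopy e /= size_rcons /=.
  by rewrite -cats1 take_size_cat.
have lc t c : (0 < degree t)%N -> leafword c t = leafword lm t by case: t.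
have gn t : (0 < degree (graft_left t))%N by case: t.
have tn : (0 < degree (tree_with_canopy w))%N.
  by case: w => [|c w] //=; case: ifP.
move=> c; rewrite lc // {c tn}; elim: w => [|[] w IH] //=.
  rewrite lc; first by rewrite IH.
  by case: w {IH} => [|c w] //=; case: ifP.
by have [s e ->] := leafword_graft_left (tree_with_canopy w); move: IH; rewrite e => -[->].
Qed.

Lemma degree_tree_with_canopy w : degree (tree_with_canopy w) = (size w).+1.
Proof.
have dg t : degree (graft_left t) = (degree t).+1.
  by elim: t => [|x IH y _] //=; rewrite IH.
by elim: w => [|c w IH] //=; case: ifP => _; rewrite ?dg /= IH.
Qed.

Lemma treeD_canopy t : (0 < degree t)%N -> treeD t = d_coef (canopy t).
Proof.
move=> t0; rewrite /d_coef !treeD_wt ?canopy_tree_with_canopy //.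
by rewrite degree_tree_with_canopy.
Qed.

(* Main.v *)
Require Import Defs.
From mathcomp Require Import all_boot all_order all_algebra all_fingroup.
From mathcomp Require Import zify ring.
From mathcomp Require Import finmap.
From mathcomp.multinomials Require Import monalg.

(** The idea is that D is a conjugate of a generator by a group-like element.

    Cut a permutation at its largest letter m, as u m v. Its coefficient in D is
    g(u) h(v), where g and h are the functions of permutations given by the
    series 1 + U and 1 + V. If g is a character of the shuffle algebra (so that
    1 + U is group-like) and h is its inverse for the convolution product, then D
    is the sum of the words g x_m g^-1, and it vanishes on the shuffles of two
    nonempty words (D_word_shuffle): D is primitive.

    Both facts about g and h come from a family of functions K_(t,s) that
    contains g = K_(-1,0) and h = K_(0,-1). It is obtained by letting the first
    and the last block of a word depend on spectral parameters t and s. The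
    parameter s is the catalytic variable of the enumeration of flows by the
    rate at the root: if t marks the rate and s = t / (1 - t), the generating
    functions of flows on chains are polynomials in s, and their kernel equation
    (block_wtS) becomes a recursion for K_(t,s) at the largest letter of a
    permutation (mould_max). From this recursion alone, induction on the length
    gives the Chasles relation K_(t,s) K_(s,r) = K_(t,r) (mould_mul) and the
    fact that each K_(t,s) is a character (mould_shuffle). The parameter 0, at
    which the recursion degenerates, is reached by polynomiality. As K_(t,t) is
    the unit, g and h are inverse to each other.

    The rest is the theory of Lie elements in the group ring. A multilinear
    element is Lie if and only if it is primitive (in_LieP): a primitive element
    is a combination of nested brackets of words that start with a fixed letter,
    because its values on these words determine it. A function of the descents
    acts on the right on primitive elements by a scalar (gmul_primitive),
    because the restrictions of a word to two complementary sets of letters are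
    constant on sets of shuffles. Hence y D = c y for each Lie element y, in
    particular for D, and D / c is a projector onto Lie elements. A trace
    computation (primitive_eigenvalue) gives c as n times the coefficient of the
    identity in D, which is ca n.-1. *)

Set Implicit Arguments.
Unset Strict Implicit.
Unset Printing Implicit Defensive.

Import Order.TTheory GRing.Theory Num.Theory.
Local Open Scope ring_scope.

(** * Shuffles and deconcatenations of words *)

(** Shuffles are listed with multiplicity, so that sums over this list are the
    values of a linear form on the shuffle product. *)
Fixpoint shuffle (T : Type) (u v : seq T) {struct u} : seq (seq T) :=
  if u is a :: u' then
    (fix shuffle_a v := if v is b :: v' then
       map (cons a) (shuffle u' v) ++ map (cons b) (shuffle_a v')
     else [:: u]) v
  else [:: v].

Arguments shuffle : simpl never.

Fixpoint splits (T : Type) (w : seq T) : seq (seq T * seq T) :=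
  ([::], w) :: (if w is c :: w' then
                  [seq (c :: x.1, x.2) | x <- splits w'] else [::]).

Section Shuffle.
Variable T : Type.
Implicit Types (u v w : seq T).

Lemma shuffle0s v : shuffle [::] v = [:: v]. Proof. by []. Qed.

Lemma shuffles0 u : shuffle u [::] = [:: u]. Proof. by case: u. Qed.

Lemma shuffle_cons a u b v : shuffle (a :: u) (b :: v) =
  map (cons a) (shuffle u (b :: v)) ++ map (cons b) (shuffle (a :: u) v).
Proof. by []. Qed.

Lemma shuffle_ind2 (P : seq T -> seq T -> Prop) :
  (forall v, P [::] v) -> (forall u, P u [::]) ->
  (forall a u b v, P u (b :: v) -> P (a :: u) v -> P (a :: u) (b :: v)) ->
  forall u v, P u v.
Proof. by move=> H1 H2 H3; elim=> // a u IHu; elim=> // b v IHv; exact: H3. Qed.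

Variable V : nmodType.
Implicit Types (F : seq T -> V) (G : seq T -> seq T -> V).

Lemma sum_shuffle_cons a u b v F :
  \sum_(w <- shuffle (a :: u) (b :: v)) F w =
  \sum_(w <- shuffle u (b :: v)) F (a :: w)
  + \sum_(w <- shuffle (a :: u) v) F (b :: w).
Proof. by rewrite shuffle_cons big_cat !big_map. Qed.

Lemma sum_splits_cons c w G :
  \sum_(x <- splits (c :: w)) G x.1 x.2 =
  G [::] (c :: w) + \sum_(x <- splits w) G (c :: x.1) x.2.
Proof. by rewrite big_cons big_map. Qed.

Lemma sum_splits0 G : \sum_(x <- splits [::]) G x.1 x.2 = G [::] [::].
Proof. by rewrite big_seq1. Qed.

Lemma sum_shuffleC u v F :
  \sum_(w <- shuffle u v) F w = \sum_(w <- shuffle v u) F w.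
Proof.
move: u v F; apply: shuffle_ind2 => [v|u|a u b v IH1 IH2] F; rewrite ?shuffles0 //.
by rewrite !sum_shuffle_cons IH1 IH2 addrC.
Qed.

Lemma sum_splits_pivot u c v G :
  \sum_(x <- splits (u ++ c :: v)) G x.1 x.2 =
  \sum_(x <- splits u) G x.1 (x.2 ++ c :: v)
  + \sum_(x <- splits v) G (u ++ c :: x.1) x.2.
Proof.
elim: u G => [|a u IH] G.
  rewrite [splits [::]]/= big_seq1 /=.
  by rewrite sum_splits_cons.
rewrite cat_cons !sum_splits_cons (IH (fun x y => G (a :: x) y)) addrA.
by rewrite (sum_splits_cons a u (fun x y => G x (y ++ c :: v))).
Qed.

(** A marked letter of one of the two words cuts each of their shuffles in two:
    the part of the other word that comes before the mark is shuffled with the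
    left part, the rest with the right part. All later recursions mark the
    largest letter of a permutation. *)
Lemma sum_shuffle_pivot u c v w F :
  \sum_(z <- shuffle (u ++ c :: v) w) F z =
  \sum_(x <- splits w) \sum_(z1 <- shuffle u x.1) \sum_(z2 <- shuffle v x.2)
     F (z1 ++ c :: z2).
Proof.
pose G u F x y := \sum_(z1 <- shuffle u x) \sum_(z2 <- shuffle v y) F (z1 ++ c :: z2) : V.
rewrite -[RHS]/(\sum_(x <- splits w) G u F x.1 x.2).
elim: u w F => [|a u IHu] w F.
  elim: w F => [|b w IHw] F.
    by rewrite shuffles0 sum_splits0 /G /= !big_seq1 shuffles0 big_seq1.
  rewrite sum_splits_cons cat0s sum_shuffle_cons {1}/G shuffle0s big_seq1; congr (_ + _).
  rewrite -[c :: v]cat0s (IHw (fun z => F (b :: z))); apply: eq_bigr => x _.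
  by rewrite /G !shuffle0s !big_seq1.
elim: w F => [|b w IHw] F.
  by rewrite shuffles0 sum_splits0 /G /= !big_seq1 shuffles0 big_seq1.
rewrite cat_cons sum_shuffle_cons -cat_cons.
rewrite (IHu _ (fun z => F (a :: z))) (IHw (fun z => F (b :: z))).
rewrite !sum_splits_cons -addrA; congr (_ + _).
  by rewrite /G !shuffles0 !big_seq1.
rewrite -big_split; apply: eq_bigr => x _ /=.
by rewrite /G sum_shuffle_cons.
Qed.

(** The bialgebra axiom: cutting a shuffle of u and v at some place amounts to
    cutting u and v and shuffling the pieces on either side. The convolution of
    two primitive functions is computed from it. *)
Lemma sum_shuffle_splits u v G :
  \sum_(w <- shuffle u v) \sum_(x <- splits w) G x.1 x.2 =
  \sum_(x <- splits u) \sum_(y <- splits v)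
     \sum_(w1 <- shuffle x.1 y.1) \sum_(w2 <- shuffle x.2 y.2) G w1 w2.
Proof.
pose H G x1 x2 y1 y2 := \sum_(w1 <- shuffle x1 y1) \sum_(w2 <- shuffle x2 y2) G w1 w2 : V.
rewrite -[RHS]/(\sum_(x <- splits u) \sum_(y <- splits v) H G x.1 x.2 y.1 y.2).
move: u v G; apply: shuffle_ind2 => [v|u|a u b v IH1 IH2] G.
- rewrite (sum_splits0 (fun x1 x2 => \sum_(y <- splits v) H G x1 x2 y.1 y.2)).
  by rewrite big_seq1; apply: eq_bigr => y _; rewrite /H !shuffle0s !big_seq1.
- rewrite shuffles0 big_seq1; apply: eq_bigr => x _.
  by rewrite (sum_splits0 (H G _ _)) /H !shuffles0 !big_seq1.
rewrite sum_shuffle_cons.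
under eq_bigr do rewrite sum_splits_cons.
under [X in _ + X]eq_bigr do rewrite sum_splits_cons.
rewrite !big_split /= (IH1 (fun x y => G (a :: x) y)) (IH2 (fun x y => G (b :: x) y)).
pose Gv v G x1 x2 := \sum_(y <- splits v) H G x1 x2 y.1 y.2 : V.
rewrite -[RHS]/(\sum_(x <- splits (a :: u)) Gv (b :: v) G x.1 x.2) sum_splits_cons.
rewrite -[in X in _ + (_ + X)]/(\sum_(x <- splits (a :: u))
  Gv v (fun x y => G (b :: x) y) x.1 x.2) sum_splits_cons.
rewrite addrACA [X in _ + X]addrCA addrA; congr (_ + _).
  rewrite {2}/Gv sum_splits_cons; congr (_ + _).
    by rewrite /H big_seq1 sum_shuffle_cons.
  by apply: eq_bigr => y _; rewrite /H !big_seq1.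
rewrite -big_split; apply: eq_bigr => x _ /=.
rewrite /Gv !sum_splits_cons -addrA; congr (_ + _).
  by rewrite /H !shuffles0 !big_seq1.
rewrite -big_split; apply: eq_bigr => y _ /=.
by rewrite /H sum_shuffle_cons.
Qed.

End Shuffle.

Lemma mem_shuffle_perm (T : eqType) (u v w : seq T) :
  w \in shuffle u v -> perm_eq w (u ++ v).
Proof.
move: u v w; apply: shuffle_ind2 => [v|u|a u b v IH1 IH2] w;
  rewrite ?shuffles0 ?mem_seq1; try by move/eqP->; rewrite ?cats0.
rewrite shuffle_cons mem_cat => /orP[] /mapP[z hz ->].
  by rewrite /= perm_cons; apply: IH1.
rewrite -[_ ++ _]/((a :: u) ++ b :: v) perm_sym perm_catC cat_cons perm_cons.
by rewrite perm_catC perm_sym; apply: IH2.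
Qed.

Lemma mem_splits (T : eqType) (w : seq T) x : x \in splits w -> w = x.1 ++ x.2.
Proof.
elim: w x => [|c w IH] x; first by rewrite mem_seq1 => /eqP->.
by rewrite inE => /orP[/eqP-> //|/mapP[y /IH -> ->]].
Qed.

Lemma shuffle_map (S T : Type) (f : S -> T) u v :
  shuffle (map f u) (map f v) = map (map f) (shuffle u v).
Proof.
move: u v; apply: shuffle_ind2 => [v|u|a u b v IH1 IH2] //; first by rewrite !shuffles0.
rewrite !map_cons !shuffle_cons -!map_cons IH1 IH2 map_cat -!map_comp.
by congr (_ ++ _); apply: eq_map.
Qed.

(** * Narayana polynomials from a catalytic variable *)

(** With p = p_0 + s q, where s is the variable of p, this is p + b q. In terms
    of s = t / (1 - t), where t marks the rate of a flow, it becomes the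
    contribution of a new vertex after multiplication by 1 + s = 1 / (1 - t):
    inputs give p / (1 - t), and an output divides by t the part of p of positive
    rate, s q, where s / t = 1 + s. *)
Definition add_output (p : {poly Qb}) : {poly Qb} := p + 'X *: drop_poly 1 p.

(** The generating function of the open flows on a chain of k vertices with
    respect to the rate of the last vertex, written in the variable
    s = t / (1 - t), in which it is a polynomial. *)
Fixpoint flow_poly (k : nat) : {poly Qb} :=
  if k is k'.+1 then (1 + 'X) * add_output (flow_poly k') else 1.

(** The coefficient of t^r in p(s), for s = t / (1 - t): as 1 / t = (1 + s) / s,
    removing the constant term and dividing by t is p |-> (1 + s) q, if
    p = p_0 + s q. *)
Definition rate_coef (r : nat) (p : {poly Qb}) : Qb :=
  (iter r (fun q => (1 + 'X) * drop_poly 1 q) p)`_0.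

Lemma rate_coefS r p :
  rate_coef r.+1 p = rate_coef r ((1 + 'X) * drop_poly 1 p).
Proof. by rewrite /rate_coef iterSr. Qed.

Lemma rate_coefD r p q : rate_coef r (p + q) = rate_coef r p + rate_coef r q.
Proof.
elim: r p q => [|r IH] p q; first exact: coefD.
by rewrite !rate_coefS linearD mulrDr IH.
Qed.

Lemma rate_coefZ r c p : rate_coef r (c *: p) = c * rate_coef r p.
Proof.
elim: r p => [|r IH] p; first exact: coefZ.
by rewrite !rate_coefS linearZ /= -scalerAr IH.
Qed.

Lemma drop_poly1_mul (p : {poly Qb}) :
  drop_poly 1 ((1 + 'X) * p) = (p`_0)%:P + (1 + 'X) * drop_poly 1 p.
Proof.
apply/polyP => i; rewrite coef_drop_poly addn1 coefD coefC !mulrDl !mul1r !coefD.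
rewrite !coefXM !coef_drop_poly addn1.
by case: i => [|i] /=; rewrite ?addr0 ?add0r ?addn1 // addrC.
Qed.

Lemma rate_coef_const r c : rate_coef r ((1 + 'X) * c%:P) = c.
Proof.
have d0 : drop_poly 1 c%:P = 0 :> {poly Qb}.
  by apply/polyP=> i; rewrite coef_drop_poly addn1 coefC coef0.
elim: r => [|r IH].
  by rewrite /rate_coef /= coefMC coefD coef1 coefX addr0 mul1r.
by rewrite rate_coefS drop_poly1_mul d0 mulr0 addr0 coefC.
Qed.

(** Partial sums of coefficients: a multiplication by 1 + s = 1 / (1 - t). *)
Lemma sum_rate_coef r p :
  \sum_(i < r.+1) rate_coef i p = rate_coef r ((1 + 'X) * p).
Proof.
elim: r p => [|r IH] p.
  by rewrite big_ord1 /rate_coef /= mulrDl mul1r coefD coefXM addr0.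
rewrite big_ord_recl; under eq_bigr do rewrite rate_coefS.
by rewrite IH rate_coefS drop_poly1_mul mulrDr rate_coefD rate_coef_const.
Qed.

Lemma big_tuple0 (T : finType) (F : 0.-tuple T -> Qb) :
  \sum_(t : 0.-tuple T) F t = F [tuple].
Proof. by apply: big_pred1 => t; rewrite [t]tuple0 [RHS]eqxx. Qed.

Lemma big_rcons_tuple (T : finType) k (F : k.+1.-tuple T -> Qb) :
  \sum_(t : k.+1.-tuple T) F t =
  \sum_(t : k.-tuple T) \sum_(x : T) F [tuple of rcons t x].
Proof.
pose h (p : k.-tuple T * T) := [tuple of rcons p.1 p.2].
have hinj : injective h.
  move=> [t x] [t' x'] /(congr1 val) /= /rcons_inj [e ->].
  by congr (_, _); apply: val_inj.
have hbij : bijective h.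
  by apply: (inj_card_bij hinj); rewrite card_prod !card_tuple expnSr.
by rewrite (reindex h) ?pair_bigA //; apply: onW_bij.
Qed.

Lemma forall_ordS k (P : pred nat) :
  [forall v : 'I_k.+1, P v] = [forall v : 'I_k, P v] && P k.
Proof.
apply/forallP/andP => [h|[/forallP h hk] v].
  split; first by apply/forallP => v; have := h (widen_ord (leqnSn k) v).
  exact: (h ord_max).
have [lt|ge] := ltnP v k; first exact: (h (Ordinal lt)).
by have -> : val v = k by apply/eqP; rewrite eqn_leq ge -ltnS ltn_ord.
Qed.

Definition last_rate O f k : int := if k is k'.+1 then rate O f k' else 0.

Definition flow_prefix k O f (r : int) : bool :=
  [&& [forall v : 'I_k, nth false O v ==> (nth 0%N f v == 0%N)],
      [forall v : 'I_k, 0 <= rate O f v]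
    & last_rate O f k == r].

Lemma rate_rcons k O f o x v : size O = k -> size f = k -> (v < k)%N ->
  rate (rcons O o) (rcons f x) v = rate O f v.
Proof.
move=> sO sf; elim: v => [|v IH] lv /=; first by rewrite !nth_rcons sO sf lv.
by rewrite !nth_rcons sO sf lv IH // ltnW.
Qed.

Lemma flow_prefix_rcons k O f (o : bool) (x : nat) (r : nat) :
  size O = k -> size f = k ->
  flow_prefix k.+1 (rcons O o) (rcons f x) r%:Z =
  flow_prefix k O f (r%:Z + (o : nat)%:Z - x%:Z) && (o ==> (x == 0%N)).
Proof.
move=> sO sf; rewrite /flow_prefix.
rewrite (@forall_ordS k
  (fun v => nth false (rcons O o) v ==> (nth 0%N (rcons f x) v == 0%N))).
rewrite (@forall_ordS k (fun v => 0 <= rate (rcons O o) (rcons f x) v)).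
have -> : [forall v : 'I_k, nth false (rcons O o) v ==> (nth 0%N (rcons f x) v == 0%N)]
   = [forall v : 'I_k, nth false O v ==> (nth 0%N f v == 0%N)].
  by apply: eq_forallb => v; rewrite !nth_rcons sO sf ltn_ord.
have -> : [forall v : 'I_k, 0 <= rate (rcons O o) (rcons f x) v]
   = [forall v : 'I_k, 0 <= rate O f v].
  by apply: eq_forallb => v; rewrite (rate_rcons _ _ sO sf).
have lr : rate (rcons O o) (rcons f x) k = x%:Z - (o : nat)%:Z + last_rate O f k.
  case: k sO sf => [|k] sO sf /=; rewrite !nth_rcons sO sf ltnn eqxx //.
  by rewrite (rate_rcons _ _ sO sf).
rewrite !nth_rcons sO sf ltnn eqxx [last_rate _ _ k.+1]/= lr.
case: [forall v, _ ==> _] => //=; case: [forall v, _] => //=; last by rewrite andbF.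
clear lr; case: o; case: x => [|x] /=; rewrite ?andbT ?andbF; lia.
Qed.

(** Flows on k vertices with inputs at most M; the bound is harmless as long as
    the final rate r satisfies r + k <= M, since a rate decreases by at most one
    at each vertex. *)
Definition flow_sum M k (r : int) : Qb :=
  \sum_(O : k.-tuple bool)
    \sum_(f : k.-tuple 'I_M.+1 | flow_prefix k O [seq val i | i <- f] r)
      'X ^+ count id O.

Lemma flow_sum_neg M k r : r < 0 -> flow_sum M k r = 0.
Proof.
move=> r0; apply: big1 => O _; rewrite big_pred0 // => f.
apply/negP => /and3P[_ /forallP h /eqP e]; move: r0; rewrite -e.
by case: k O f h {e} => [|k] O f h //=; have := h ord_max => /=; lia.
Qed.

(** The last vertex either is an output, and the rate was r + 1 before it, or
    receives r - i inputs, where i is the rate before it. *)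
Lemma flow_sumS M k (r : nat) : (r <= M)%N ->
  flow_sum M k.+1 r%:Z =
  \sum_(i < r.+1) flow_sum M k i%:Z + 'X * flow_sum M k r.+1%:Z.
Proof.
move=> rM.
pose S (O : k.-tuple bool) r := \sum_(f : k.-tuple 'I_M.+1)
  (if flow_prefix k O [seq val i | i <- f] r then 'X ^+ count id O else 0) : Qb.
have SE r' : flow_sum M k r' = \sum_O S O r'.
  by apply: eq_bigr => O _; rewrite big_mkcond.
have step : flow_sum M k.+1 r%:Z =
    \sum_(x < M.+1) flow_sum M k (r%:Z - x%:Z) + 'X * flow_sum M k r.+1%:Z.
  rewrite !SE mulr_sumr; under [in RHS]eq_bigr do rewrite SE.
  rewrite exchange_big -big_split /flow_sum big_rcons_tuple; apply: eq_bigr => O _ /=.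
  rewrite big_bool /= addrC; congr (_ + _).
    rewrite big_mkcond big_rcons_tuple exchange_big; apply: eq_bigr => x _.
    apply: eq_bigr => f _; rewrite /= map_rcons flow_prefix_rcons ?size_map ?size_tuple //.
    by rewrite /= addr0 andbT -cats1 count_cat /= !addn0.
  rewrite big_mkcond big_rcons_tuple mulr_sumr; apply: eq_bigr => f _.
  rewrite (bigD1 ord0) //= big1 ?addr0 => [|x x0].
    rewrite map_rcons flow_prefix_rcons ?size_map ?size_tuple //= andbT.
    have -> : r%:Z + 1 - 0 = r.+1%:Z by lia.
    by case: ifP => _; rewrite ?mulr0 // -cats1 count_cat exprD mulrC.
  rewrite map_rcons flow_prefix_rcons ?size_map ?size_tuple //=.
  by rewrite -val_eqE in x0; rewrite (negbTE x0) andbF.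
rewrite step; congr (_ + _).
(* More than r inputs would require a negative rate before the last vertex. *)
rewrite (reindex_inj rev_ord_inj) /=.
rewrite -(big_mkord xpredT (fun i => flow_sum M k (r%:Z - (M.+1 - i.+1)%N%:Z))).
rewrite -(big_mkord xpredT (fun i => flow_sum M k i%:Z)).
rewrite (@big_cat_nat _ _ _ (M - r)) //=; last by rewrite ltnW // ltnS leq_subr.
rewrite big1_seq ?add0r => [|i /andP[_]]; last first.
  by rewrite mem_index_iota => /andP[_ li]; apply: flow_sum_neg; lia.
rewrite -{1}[(M - r)%N]add0n big_addn.
have -> : (M.+1 - (M - r) = r.+1)%N by lia.
rewrite !big_mkord; apply: eq_bigr => -[i li] _ /=; congr flow_sum; lia.
Qed.

Lemma flow_sum_poly M k r : (r + k <= M)%N ->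
  flow_sum M k r%:Z = rate_coef r (flow_poly k).
Proof.
elim: k r => [|k IH] r le.
  rewrite /flow_sum big_tuple0 big_mkcond big_tuple0.
  have h (P : pred 'I_0) : [forall v, P v] by apply/forallP => -[].
  rewrite /flow_prefix !h /=; case: r le => [|r] _.
    by rewrite /rate_coef /= coef1 expr0.
  rewrite rate_coefS; have -> : drop_poly 1 (1 : {poly Qb}) = 0.
    by apply/polyP=> i; rewrite coef_drop_poly addn1 coef1 coef0.
  by rewrite mulr0 -[X in rate_coef r X](scale0r 1) rate_coefZ mul0r.
rewrite flow_sumS; last by lia.
rewrite IH; last by lia.
rewrite (eq_bigr (fun i : 'I_r.+1 => rate_coef i (flow_poly k))); last first.
  by move=> i _; apply: IH; have := ltn_ord i; lia.
rewrite sum_rate_coef rate_coefS -rate_coefZ -rate_coefD /= /add_output.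
by rewrite mulrDr scalerAr.
Qed.

(** Closed flows are those of rate 0, i.e. t = 0, i.e. s = 0. *)
Lemma ca_flow_poly n : ca n = (flow_poly n).[0].
Proof.
rewrite horner_coef0; case: n => [|n]; first by rewrite coef1.
have -> : (flow_poly n.+1)`_0 = rate_coef 0 (flow_poly n.+1) by [].
by rewrite -(@flow_sum_poly n.+1).
Qed.

(** At b = 0 only the flow without inputs and outputs is left. *)
Lemma ca_neq0 n : ca n != 0.
Proof.
suff h : (ca n).[0] = 1.
  by apply/eqP => e; move: h; rewrite e horner0 => /eqP; rewrite eq_sym oner_eq0.
rewrite ca_flow_poly [(flow_poly n).[0]]horner_coef0; elim: n => [|n IH].
  by rewrite coef1 hornerC.
rewrite /= /add_output mulrDl mul1r coefD coefXM addr0 coefD coefZ.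
by rewrite hornerD hornerM hornerX mul0r addr0.
Qed.

(** The weight of a block of k + 1 equal letters, deformed by a spectral
    parameter s: it is ca k.+1 at s = 0 (block_wt_at0), and, if k > 0,
    b ca k at s = -1 (block_wtN1). *)
Definition block_wt (k : nat) (s : Qb) : Qb := (add_output (flow_poly k)).[s].

Lemma block_wtE k s : s * block_wt k s = (s + 'X) * (flow_poly k).[s] - 'X * ca k.
Proof.
rewrite /block_wt /add_output hornerD hornerZ ca_flow_poly.
have e : (flow_poly k).[s] = (flow_poly k).[0] + s * (drop_poly 1 (flow_poly k)).[s].
  rewrite -{1}(poly_take_drop 1 (flow_poly k)) hornerD hornerM hornerXn expr1 mulrC.
  congr (_ + _); rewrite horner_coef0; set p := flow_poly k.
  have -> : take_poly 1 p = (p`_0)%:P; last by rewrite hornerC.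
  by apply/polyP => i; rewrite coef_take_poly coefC; case: i.
rewrite e; ring.
Qed.

Lemma block_wt0 s : block_wt 0 s = 1.
Proof.
rewrite /block_wt /add_output /=.
have -> : drop_poly 1 (1 : {poly Qb}) = 0.
  by apply/polyP=> i; rewrite coef_drop_poly addn1 coef1 coef0.
by rewrite scaler0 addr0 hornerC.
Qed.

Lemma flow_polyS s k : (flow_poly k.+1).[s] = (1 + s) * block_wt k s.
Proof. by rewrite /= hornerM hornerD hornerX hornerC. Qed.

Lemma block_wt_at0 k : block_wt k 0 = ca k.+1.
Proof. by rewrite ca_flow_poly flow_polyS addr0 mul1r. Qed.

(** The kernel equation of the catalytic variable s: up to the boundary term at
    s = 0, a longer block costs the factor (s + b)(1 + s) / s. *)
Lemma block_wtS k s :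
  s * block_wt k.+1 s = (s + 'X) * (1 + s) * block_wt k s - 'X * block_wt k 0.
Proof. by rewrite block_wtE flow_polyS block_wt_at0 mulrA. Qed.

Lemma block_wtN1 k : block_wt k.+1 (-1) = 'X * ca k.+1.
Proof. by apply: oppr_inj; rewrite -[LHS]mulN1r block_wtS block_wt_at0; ring. Qed.

(** * A two-parameter family of characters *)

Definition spectral_block (c : letter) (x : Qb) (k : nat) : Qb :=
  if c then (-1) ^+ k.+1 * block_wt k x else block_wt k 0.

Arguments spectral_block : simpl never.

(** The weight of the word m w p, read from left to right; the current block has
    k + 1 letters c and the parameter x. The first block, made of m, carries
    the parameter t, the last one, made of p, the parameter s, the other ones the
    parameter 0, and each change from p to m contributes a factor b. *)
Fixpoint spectral_wt (s : Qb) (c : letter) (x : Qb) (k : nat) (w : seq letter) : Qb :=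
  if w is y :: w' then
    if y == c then spectral_wt s c x k.+1 w'
    else spectral_block c x k * (if c then 1 else 'X) * spectral_wt s y 0 0 w'
  else if c then spectral_block lm x k else block_wt k.+1 s.

(** The characters K_(t,s). At (-1, 0) and (0, -1) these are the functions of the
    descents that come from the series U and V, see mould_l0 and mould_0r. *)
Definition mould (t s : Qb) (w : seq nat) : Qb :=
  if w is [::] then 1
  else (t - s) * spectral_wt s lm t 0 (descent_letters w).

(** The two letters of a peak p m lie in different blocks, neither of which is
    the first or the last one of the word: hence the parameter 0 on both sides. *)
Lemma spectral_wt_peak s c x k u v :
  spectral_wt s c x k (u ++ [:: lp, lm & v]) =
  'X * spectral_wt 0 c x k u * spectral_wt s lm 0 0 v.
Proof.
elim: u c x k => [|y u IH] c x k /=.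
  by case: c => /=; rewrite /spectral_block /= ?block_wt0; ring.
by case: eqP => _; rewrite IH //; ring.
Qed.

Lemma spectral_block_m t k : t * spectral_block lm t k.+1 =
  'X * spectral_block lm 0 k - (t + 'X) * (1 + t) * spectral_block lm t k.
Proof.
rewrite /spectral_block /lm [_ ^+ k.+2]exprS !mulN1r !mulNr mulrN mulrCA.
by rewrite block_wtS; ring.
Qed.

Lemma spectral_wt_m s t k w : t * spectral_wt s lm t k.+1 w =
  'X * spectral_wt s lm 0 k w - (t + 'X) * (1 + t) * spectral_wt s lm t k w.
Proof.
elim: w k => [|y w IH] k /=; first exact: spectral_block_m.
case: eqP => _; first exact: IH.
by rewrite mulr1 [LHS]mulrA [t * _]spectral_block_m /lm; ring.
Qed.

Lemma spectral_wt_p s c x k w : s * spectral_wt s c x k (rcons w lp) =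
  (s + 'X) * (1 + s) * spectral_wt s c x k w - 'X * spectral_wt 0 c x k w.
Proof.
elim: w c x k => [|y w IH] c x k /=.
  case: c => /=; last exact: block_wtS.
  have := block_wtS 0 s; rewrite !block_wt0 => e.
  by rewrite !mulr1 mulrCA e; ring.
case: eqP => _; first exact: IH.
by rewrite mulrCA IH; ring.
Qed.

Lemma descent_letters_cat u a b v : descent_letters (rcons u a ++ b :: v) =
  descent_letters (rcons u a) ++ (b < a)%N :: descent_letters (b :: v).
Proof.
case: u => [|c u] /=; first by case: (b < a)%N.
rewrite pairmap_cat; congr (_ ++ _).
by rewrite last_rcons /=; case: (b < a)%N.
Qed.

(** The largest letter creates a peak of the descent word, which disappears on
    the side where no letter is left. *)
Lemma descent_letters_max u m v :
  all (fun i => i < m)%N u -> all (fun i => i < m)%N v ->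
  descent_letters (u ++ m :: v) =
  (if u is [::] then [::] else rcons (descent_letters u) lp)
  ++ (if v is [::] then [::] else lm :: descent_letters v).
Proof.
have right : all (fun i => i < m)%N v -> descent_letters (m :: v) =
    (if v is [::] then [::] else lm :: descent_letters v).
  by case: v => //= b v /andP[-> _].
move=> hu /right <-; case/lastP: u hu => // u a; rewrite all_rcons => /andP[am _].
rewrite descent_letters_cat ltnNge ltnW //=.
by case: u => [|c u] //=; rewrite -cat_rcons.
Qed.

(** The recursion that governs K_(t,s), at the largest letter m of a permutation.
    In terms of A(s) = (1 + s)(s + b) / s it says that
    K_(t,s)(u m v) = A(s) K_(t,s)(u) [v empty] - A(t) [u empty] K_(t,s)(v)
                     + (b/t - b/s) K_(t,0)(u) K_(0,s)(v):
    the peak of a letter inside the word is cut, and at either end of the word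
    the kernel equation block_wtS is used. *)
Lemma mould_max t s u m v :
  all (fun i => i < m)%N u -> all (fun i => i < m)%N v ->
  t * s * mould t s (u ++ m :: v) =
    t * ((1 + s) * (s + 'X)) * (mould t s u * (nilp v)%:R)
  - s * ((1 + t) * (t + 'X)) * ((nilp u)%:R * mould t s v)
  + 'X * (s - t) * (mould t 0 u * mould 0 s v).
Proof.
move=> hu hv; have -> : mould t s (u ++ m :: v) =
  (t - s) * spectral_wt s lm t 0 (descent_letters (u ++ m :: v)) by case: (u).
rewrite (descent_letters_max hu hv).
case: u v {hu hv} => [|a u] [|c v].
- by rewrite /= /spectral_block /= block_wt0; ring.
- rewrite cat0s; set w := descent_letters _.
  transitivity (s * (t - s) * (t * spectral_wt s lm t 1 w)); first by rewrite /=; ring.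
  by rewrite spectral_wt_m /= -/w; ring.
- rewrite cats0; set w := descent_letters _.
  transitivity (t * (t - s) * (s * spectral_wt s lm t 0 (rcons w lp))); first by ring.
  by rewrite spectral_wt_p /= -/w; ring.
set w := descent_letters _; set w' := descent_letters _.
by rewrite cat_rcons spectral_wt_peak /= -/w -/w'; ring.
Qed.

(** * The Chasles relation and the character property *)

(** Polynomial functions of a parameter. Identities are first proved for nonzero
    parameters, where the recursion mould_max determines K_(t,s), and extended
    to the value 0 by polyfun_eq. *)
Definition polyfun (f : Qb -> Qb) : Prop := exists p : {poly Qb}, forall x, f x = p.[x].

Lemma polyfun_const c : polyfun (fun=> c).
Proof. by exists c%:P => x; rewrite hornerC. Qed.

Lemma polyfun_id : polyfun id.
Proof. by exists 'X => x; rewrite hornerX. Qed.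

Lemma polyfunD f g : polyfun f -> polyfun g -> polyfun (fun x => f x + g x).
Proof. by move=> [p fp] [q gq]; exists (p + q) => x; rewrite hornerD fp gq. Qed.

Lemma polyfunM f g : polyfun f -> polyfun g -> polyfun (fun x => f x * g x).
Proof. by move=> [p fp] [q gq]; exists (p * q) => x; rewrite hornerM fp gq. Qed.

Lemma polyfun_sum (I : Type) (r : seq I) (f : Qb -> I -> Qb) :
  (forall i, polyfun (fun x => f x i)) -> polyfun (fun x => \sum_(i <- r) f x i).
Proof.
move=> hf; elim: r => [|i r [p hp]].
  by exists 0 => x; rewrite big_nil horner0.
by have [q hq] := hf i; exists (q + p) => x; rewrite big_cons hornerD hq hp.
Qed.

Lemma polyfun_eq (f g : Qb -> Qb) : polyfun f -> polyfun g ->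
  (forall x : Qb, x != 0 -> f x = g x) -> forall x : Qb, f x = g x.
Proof.
move=> [p fp] [q gq] fg x; suff e : p = q by rewrite fp gq e.
apply/eqP; rewrite -subr_eq0; apply/eqP.
(* The nonzero integers provide as many roots as needed. *)
set d := p - q; pose rs : seq Qb := [seq i.+1%:R | i <- iota 0 (size d)].
have nat_inj (i j : nat) : (i%:R == j%:R :> Qb) = (i == j).
  by rewrite -!polyC_natr (inj_eq (@polyC_inj _)) eqr_nat.
apply: (@roots_geq_poly_eq0 _ d rs); last by rewrite size_map size_iota.
  apply/allP => _ /mapP[i _ ->]; rewrite rootE /d hornerD hornerN -fp -gq fg ?subrr //.
  by rewrite (nat_inj i.+1 0%N).
rewrite map_inj_uniq ?iota_uniq // => i j /eqP.
by rewrite nat_inj eqSS => /eqP.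
Qed.

Lemma polyfun_spectral_block c k : polyfun (fun x => spectral_block c x k).
Proof.
case: c; last exact: polyfun_const.
by apply: polyfunM; [exact: polyfun_const|exists (add_output (flow_poly k))].
Qed.

Lemma polyfun_spectral_l s c k w : polyfun (fun t => spectral_wt s c t k w).
Proof.
elim: w k => [|y w IH] k /=.
  by case: c; [exact: polyfun_spectral_block|exact: polyfun_const].
case: eqP => _; first exact: IH.
apply: polyfunM; last exact: polyfun_const.
by apply: polyfunM; [exact: polyfun_spectral_block|exact: polyfun_const].
Qed.

Lemma polyfun_spectral_r c t k w : polyfun (fun s => spectral_wt s c t k w).
Proof.
elim: w c t k => [|y w IH] c t k /=.
  by case: c; [exact: polyfun_const|exists (add_output (flow_poly k.+1))].
case: eqP => _; first exact: IH.
by apply: polyfunM; [exact: polyfun_const|exact: IH].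
Qed.

Lemma polyfun_mould_l s w : polyfun (fun t => mould t s w).
Proof.
case: w => [|a w]; first exact: polyfun_const.
apply: polyfunM; last exact: polyfun_spectral_l.
by apply: polyfunD; [exact: polyfun_id|exact: polyfun_const].
Qed.

Lemma polyfun_mould_r t w : polyfun (fun s => mould t s w).
Proof.
case: w => [|a w]; first exact: polyfun_const.
apply: polyfunM; last exact: polyfun_spectral_r.
apply: polyfunD; first exact: polyfun_const.
by exists (- 'X) => x; rewrite hornerN hornerX.
Qed.

Lemma split_max (w : seq nat) : w != [::] -> uniq w -> exists u m v,
  [/\ w = u ++ m :: v, all (fun i => i < m)%N u & all (fun i => i < m)%N v].
Proof.
elim: w => // a w IH _ /= /andP[aw uw].
have [->|wn] := eqVneq w [::]; first by exists [::], a, [::].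
have [u [m [v [e hu hv]]]] := IH wn uw.
have [am|ma|e'] := ltngtP a m.
- by exists (a :: u), m, v; rewrite e /= am.
- exists [::], a, w; split=> //; rewrite e all_cat /= ma.
  by apply/andP; split; [apply: sub_all hu|apply: sub_all hv] => i /ltn_trans; apply.
- by move: aw; rewrite e mem_cat inE e' eqxx orbT.
Qed.

(** Shuffles being commutative, the largest letter of two words can be assumed
    to be in the first one. *)
Lemma max_wlog (P : seq nat -> seq nat -> Prop) :
  (forall u v, P v u -> P u v) ->
  (forall u1 m u2 v, all (fun i => i < m)%N u1 -> all (fun i => i < m)%N u2 ->
     all (fun i => i < m)%N v -> v != [::] -> uniq ((u1 ++ m :: u2) ++ v) ->
     P (u1 ++ m :: u2) v) ->
  forall u v, u != [::] -> v != [::] -> uniq (u ++ v) -> P u v.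
Proof.
move=> sym H u v u0 v0 uuv.
have [uu uv] : uniq u /\ uniq v by move: uuv; rewrite cat_uniq => /and3P[].
have [u1 [m [u2 [eu hu1 hu2]]]] := split_max u0 uu.
have [v1 [m' [v2 [ev hv1 hv2]]]] := split_max v0 uv.
have tr a b x : (a < b)%N -> all (fun i => i < a)%N x -> all (fun i => i < b)%N x.
  by move=> ab; apply: sub_all => i /ltn_trans; apply.
have [mm'|m'm|e] := ltngtP m m'.
- apply: sym; rewrite ev; apply: H; rewrite -?ev // 1?uniq_catC //.
  by rewrite eu all_cat /= mm' !(tr _ _ _ mm').
- rewrite eu; apply: H; rewrite -?eu //.
  by rewrite ev all_cat /= m'm !(tr _ _ _ m'm).
- move: uuv; rewrite cat_uniq => /and3P[_ /hasPn/(_ m)].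
  by rewrite eu ev e !mem_cat !inE eqxx !orbT => /(_ isT).
Qed.

Section SumSplits.
Variables (T : Type) (R : comNzRingType).
Implicit Types (w : seq T) (f : seq T -> R).

Lemma sum_splits_nilr w f : \sum_(x <- splits w) f x.1 * (nilp x.2)%:R = f w.
Proof.
elim: w f => [|c w IH] f; first by rewrite big_seq1 mulr1.
by rewrite big_cons big_map mulr0 add0r (IH (fun z => f (c :: z))).
Qed.

Lemma sum_splits_nill w f : \sum_(x <- splits w) (nilp x.1)%:R * f x.2 = f w.
Proof.
case: w => [|c w]; first by rewrite big_seq1 mul1r.
by rewrite big_cons big_map mul1r big1 ?addr0 // => x _; rewrite mul0r.
Qed.

Lemma sum_shuffle_nil u v :
  \sum_(w <- @shuffle T u v) (nilp w)%:R = (nilp u)%:R * (nilp v)%:R :> R.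
Proof.
case: u v => [|a u] [|b v]; rewrite ?shuffles0 ?shuffle0s ?big_seq1 ?mul1r ?mulr1 //.
by rewrite sum_shuffle_cons !big1 ?addr0 ?mul0r.
Qed.

Lemma sum_shuffleM (u u' v v' : seq T) f g :
  \sum_(w <- shuffle u v) \sum_(w' <- shuffle u' v') f w * g w' =
  (\sum_(w <- shuffle u v) f w) * (\sum_(w' <- shuffle u' v') g w').
Proof. by rewrite big_distrlr. Qed.

End SumSplits.

(** The Chasles relation K_(t,s) K_(s,r) = K_(t,r) for the convolution product.
    By induction: on either side of the largest letter the terms that contain
    A(s) cancel, and b/t - b/s and b/s - b/r add up. *)
Lemma mould_mul t s r w : uniq w ->
  \sum_(x <- splits w) mould t s x.1 * mould s r x.2 = mould t r w.
Proof.
have [N] := ubnP (size w); elim: N t s r w => // N IH t s r w lN uw.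
have [->|w0] := eqVneq w [::]; first by rewrite big_seq1 mulr1.
have [u [m [v [e hu hv]]]] := split_max w0 uw.
have su : (size u < N)%N by move: lN; rewrite e size_cat /=; lia.
have sv : (size v < N)%N by move: lN; rewrite e size_cat /=; lia.
move: uw; rewrite e cat_uniq /= => /and3P[uu _ /andP[_ uv]] {w w0 lN e}.
pose L t s r := \sum_(x <- splits (u ++ m :: v)) mould t s x.1 * mould s r x.2.
rewrite -[LHS]/(L t s r).
have Lr t' s' : polyfun (fun r => L t' s' r).
  apply: polyfun_sum => x; apply: polyfunM; [exact: polyfun_const|exact: polyfun_mould_r].
have Ls t' r' : polyfun (fun s => L t' s r').
  by apply: polyfun_sum => x; apply: polyfunM; [exact: polyfun_mould_r|exact: polyfun_mould_l].
have Lt s' r' : polyfun (fun t => L t s' r').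
  by apply: polyfun_sum => x; apply: polyfunM; [exact: polyfun_mould_l|exact: polyfun_const].
move: r; apply: polyfun_eq => // [|r r0]; first exact: polyfun_mould_r.
move: s; apply: (@polyfun_eq (fun s => L t s r) (fun=> _)) => // [|s s0].
  exact: polyfun_const.
move: t; apply: (@polyfun_eq (fun t => L t s r)) => // [|t t0]; first exact: polyfun_mould_l.
apply: (mulfI (mulf_neq0 t0 (mulf_neq0 s0 r0))).
rewrite /L (sum_splits_pivot u m v (fun x y => mould t s x * mould s r y)).
rewrite mulrDr.
have subl (x : seq nat * seq nat) : x \in splits u -> all (fun i => i < m)%N x.2.
  by move/mem_splits => e; move: hu; rewrite e all_cat => /andP[].
have subr' (x : seq nat * seq nat) : x \in splits v -> all (fun i => i < m)%N x.1.
  by move/mem_splits => e; move: hv; rewrite e all_cat => /andP[].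
have -> : t * (s * r) * (\sum_(x <- splits u) mould t s x.1 * mould s r (x.2 ++ m :: v)) =
    t * s * ((1 + r) * (r + 'X)) * (nilp v)%:R * mould t r u
  - t * r * ((1 + s) * (s + 'X)) * mould s r v * mould t s u
  + t * 'X * (r - s) * mould 0 r v * mould t 0 u.
  rewrite -(IH t s r) // -(IH t s 0) // -[mould t s u](sum_splits_nilr u).
  rewrite !mulr_sumr -sumrB -big_split big_seq [RHS]big_seq; apply: eq_bigr => x xs /=.
  transitivity (t * mould t s x.1 * (s * r * mould s r (x.2 ++ m :: v))); first by ring.
  by rewrite (mould_max _ _ (subl _ xs) hv); ring.
have -> : t * (s * r) * (\sum_(x <- splits v) mould t s (u ++ m :: x.1) * mould s r x.2) =
    r * t * ((1 + s) * (s + 'X)) * mould t s u * mould s r v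
  - r * s * ((1 + t) * (t + 'X)) * (nilp u)%:R * mould t r v
  + r * 'X * (s - t) * mould t 0 u * mould 0 r v.
  rewrite -(IH t s r) // -(IH 0 s r) // -[mould s r v](sum_splits_nill v).
  rewrite !mulr_sumr -sumrB -big_split big_seq [RHS]big_seq; apply: eq_bigr => x xs /=.
  transitivity (r * mould s r x.2 * (t * s * mould t s (u ++ m :: x.1))); first by ring.
  by rewrite (mould_max _ _ hu (subr' _ xs)); ring.
transitivity (s * (t * r * mould t r (u ++ m :: v))); last by ring.
by rewrite (mould_max _ _ hu hv); ring.
Qed.

(** K_(t,s) is a character of the shuffle algebra. By induction through
    mould_max and sum_shuffle_pivot: the other word v is deconcatenated around the
    largest letter, and in the last term of the recursion the pieces of v give
    (K_(t,0) K_(0,s))(v), which is K_(t,s)(v) by the Chasles relation. *)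
Lemma mould_shuffle t s u v : uniq (u ++ v) ->
  \sum_(w <- shuffle u v) mould t s w = mould t s u * mould t s v.
Proof.
have [N] := ubnP (size u + size v).
elim: N t s u v => // N IH t s u v lN uuv.
have [->|u0] := eqVneq u [::]; first by rewrite shuffle0s big_seq1 mul1r.
have [->|v0] := eqVneq v [::]; first by rewrite shuffles0 big_seq1 mulr1.
move: u v u0 v0 uuv lN; apply: max_wlog => [u v H lN|u1 m u2 v hu1 hu2 hv v0 uuv lN].
  by rewrite sum_shuffleC mulrC H // addnC.
set u := u1 ++ m :: u2 in uuv lN *; have eu : u = u1 ++ m :: u2 by [].
have s1 : (size u1 + size v < N)%N by move: lN; rewrite eu size_cat /=; lia.
have s2 : (size u2 + size v < N)%N by move: lN; rewrite eu size_cat /=; lia.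
pose L t s := \sum_(w <- shuffle u v) mould t s w.
rewrite -[LHS]/(L t s).
have Lr t' : polyfun (fun s => L t' s) by apply: polyfun_sum => x; exact: polyfun_mould_r.
have Ll s' : polyfun (fun t => L t s') by apply: polyfun_sum => x; exact: polyfun_mould_l.
move: s; apply: polyfun_eq => // [|s s0].
  by apply: polyfunM; exact: polyfun_mould_r.
move: t; apply: (@polyfun_eq (fun t => L t s)) => // [|t t0].
  by apply: polyfunM; exact: polyfun_mould_l.
apply: (mulfI (mulf_neq0 t0 s0)).
have uv : uniq v by move: uuv; rewrite cat_uniq => /and3P[].
have sub1 (x : seq nat * seq nat) : x \in splits v -> uniq (u1 ++ x.1) /\ uniq (u2 ++ x.2).
  move=> /mem_splits e; move: uuv; rewrite eu e => uuv; split; apply: subseq_uniq uuv.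
    by apply: cat_subseq; exact: prefix_subseq.
  by apply: cat_subseq; rewrite -?cat_rcons; exact: suffix_subseq.
have size1 (x : seq nat * seq nat) : x \in splits v ->
    (size u1 + size x.1 < N)%N /\ (size u2 + size x.2 < N)%N.
  move/mem_splits => e; split; [apply: leq_ltn_trans s1|apply: leq_ltn_trans s2];
    by rewrite leq_add2l e size_cat ?leq_addr ?leq_addl.
have below (x : seq nat * seq nat) z : x \in splits v ->
    (z \in shuffle u1 x.1 -> all (fun i => i < m)%N z)
    /\ (z \in shuffle u2 x.2 -> all (fun i => i < m)%N z).
  move/mem_splits => e; move: hv; rewrite e all_cat => /andP[h1 h2].
  by split=> /mem_shuffle_perm/perm_all->; rewrite all_cat ?hu1 ?hu2.
transitivity (\sum_(x <- splits v) (
    t * ((1 + s) * (s + 'X)) *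
      (mould t s u1 * mould t s x.1 * ((nilp u2)%:R * (nilp x.2)%:R))
  - s * ((1 + t) * (t + 'X)) *
      ((nilp u1)%:R * (nilp x.1)%:R * (mould t s u2 * mould t s x.2))
  + 'X * (s - t) * (mould t 0 u1 * mould t 0 x.1 * (mould 0 s u2 * mould 0 s x.2)))).
  rewrite /L eu sum_shuffle_pivot mulr_sumr big_seq [RHS]big_seq.
  apply: eq_bigr => x xs; have [[q1 q2] [l1 l2]] := (sub1 x xs, size1 x xs).
  rewrite -!IH // -!sum_shuffle_nil -!sum_shuffleM !mulr_sumr -sumrB -big_split.
  rewrite big_seq [RHS]big_seq; apply: eq_bigr => z1 z1s /=.
  rewrite !mulr_sumr -sumrB -big_split big_seq [RHS]big_seq; apply: eq_bigr => z2 z2s /=.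
  by rewrite mould_max ?(proj1 (below x z1 xs)) ?(proj2 (below x z2 xs)).
transitivity (t * s * mould t s (u1 ++ m :: u2) * mould t s v); last by rewrite eu mulrA.
rewrite mould_max // [RHS]mulrDl [X in _ = X + _]mulrBl; set V := mould t s v.
have e1 : V = \sum_(x <- splits v) mould t s x.1 * (nilp x.2)%:R by rewrite sum_splits_nilr.
have e2 : V = \sum_(x <- splits v) (nilp x.1)%:R * mould t s x.2 by rewrite sum_splits_nill.
have e3 : V = \sum_(x <- splits v) mould t 0 x.1 * mould 0 s x.2 by rewrite mould_mul.
rewrite {1}e1 {1}e2 {}e3 !mulr_sumr -sumrB -big_split.
by apply: eq_bigr => x _ /=; ring.
Qed.

(** * The coefficients of D, primitive for the shuffle product *)

Local Arguments ca : simpl never.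

Lemma d_coef_wt w : d_coef w = word_wt w.
Proof.
by rewrite /d_coef treeD_wt ?canopy_tree_with_canopy ?degree_tree_with_canopy.
Qed.

Lemma ca1 : ca 1 = 1.
Proof. by rewrite -block_wt_at0 block_wt0. Qed.

(** Here a factor b stands at each change from p to m, whereas the weight of D
    has it at each change from m to p; the numbers of these changes in a word that
    starts with m differ by one if the word ends with p, which the weight b ca k
    of a last block at the parameter -1 makes up for. *)
Lemma spectral_wt_right k w :
  spectral_wt (-1) lm 0 k w = wt lm k.+1 w /\
  spectral_wt (-1) lp 0 k w = 'X * wt lp k.+1 w.
Proof.
elim: w k => [|y w IH] k /=.
  by rewrite /spectral_block /blk /= block_wt_at0 block_wtN1.
have [IHm IHp] := IH 0%N; have [IHm' IHp'] := IH k.+1.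
rewrite /lm /lp in IHm IHp IHm' IHp' *.
case: y => /=; split=> //; rewrite /spectral_block /blk /= block_wt_at0 ?IHp ?IHm; ring.
Qed.

(** The letter p that completes the word is one more change from m to p if the
    current block is made of m. *)
Lemma spectral_wt_left k w :
  'X * spectral_wt 0 lm 0 k w = wt lm k.+1 (rcons w lp) /\
  spectral_wt 0 lp 0 k w = wt lp k.+1 (rcons w lp).
Proof.
elim: w k => [|y w IH] k /=.
  by rewrite /spectral_block /blk /= !block_wt_at0 ca1 mulr1 mulrC.
have [IHm IHp] := IH 0%N; have [IHm' IHp'] := IH k.+1.
rewrite /lm /lp in IHm IHp IHm' IHp' *.
case: y => /=; split=> //; rewrite /spectral_block /blk /= block_wt_at0 -?IHp -?IHm; ring.
Qed.

Lemma mould_l0 a w : mould (-1) 0 (a :: w) = word_wt (rcons (descent_letters (a :: w)) lp).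
Proof.
rewrite /mould subr0 mulN1r; case: (descent_letters _) => [|[] {}w].
- by rewrite /= /spectral_block block_wt0 ca1 expr1 mulr1 opprK.
- have := spectral_wt_m 0 (-1) 0 w; rewrite subrr mulr0 mul0r subr0 mulN1r.
  by have [-> _] := spectral_wt_left 0 w.
- have [_ e] := spectral_wt_left 0 w; rewrite /lm /lp in e *.
  by rewrite /= e /spectral_block block_wt0 expr1 !mulr1 mulN1r opprK.
Qed.

Lemma mould_0r a w : mould 0 (-1) (a :: w) = word_wt (lm :: descent_letters (a :: w)).
Proof.
rewrite /mould sub0r opprK mul1r.
by have [-> _] := spectral_wt_right 0 (descent_letters (a :: w)).
Qed.

Definition D_word (w : seq nat) : Qb :=
  if w is [::] then 0 else word_wt (descent_letters w).

(** D is a conjugate: the coefficient of u m v is g(u) h(v), where g = K_(-1,0)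
    and h = K_(0,-1) are inverse to each other by the Chasles relation. *)
Lemma D_word_max u m v :
  all (fun i => i < m)%N u -> all (fun i => i < m)%N v ->
  D_word (u ++ m :: v) = mould (-1) 0 u * mould 0 (-1) v.
Proof.
move=> hu hv; have -> : D_word (u ++ m :: v) = word_wt (descent_letters (u ++ m :: v)).
  by case: (u).
rewrite descent_letters_max //; case: u v {hu hv} => [|a u] [|b v].
- by rewrite /= mulr1.
- by rewrite mould_0r mul1r cat0s.
- by rewrite mould_l0 mulr1 cats0.
- by rewrite mould_l0 mould_0r -word_wt_cut.
Qed.

(** Shuffling v into u1 m u2 gives g(u1) h(u2) times the value at v of the
    convolution g h = K_(-1,-1), which vanishes on nonempty words. *)
Lemma D_word_shuffle u v : u != [::] -> v != [::] -> uniq (u ++ v) ->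
  \sum_(w <- shuffle u v) D_word w = 0.
Proof.
move: u v; apply: max_wlog => [u v|u1 m u2 v hu1 hu2 hv v0 uuv].
  by rewrite sum_shuffleC.
transitivity (mould (-1) 0 u1 * mould 0 (-1) u2 *
    \sum_(x <- splits v) mould (-1) 0 x.1 * mould 0 (-1) x.2); last first.
  rewrite mould_mul; last by move: uuv; rewrite cat_uniq => /and3P[].
  by case: v v0 {hv uuv} => // a v _; rewrite /mould subrr mul0r mulr0.
rewrite sum_shuffle_pivot mulr_sumr big_seq [RHS]big_seq; apply: eq_bigr => x xs.
have e := mem_splits xs.
have q1 : uniq (u1 ++ x.1).
  by apply: subseq_uniq uuv; rewrite e; apply: cat_subseq; exact: prefix_subseq.
have q2 : uniq (u2 ++ x.2).
  apply: subseq_uniq uuv; rewrite e; apply: cat_subseq; rewrite -?cat_rcons; exact: suffix_subseq.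
move: hv; rewrite e all_cat => /andP[h1 h2].
rewrite mulrACA -!mould_shuffle // -sum_shuffleM.
rewrite big_seq [RHS]big_seq; apply: eq_bigr => z1 /mem_shuffle_perm/perm_all p1.
rewrite big_seq [RHS]big_seq; apply: eq_bigr => z2 /mem_shuffle_perm/perm_all p2.
by rewrite D_word_max ?p1 ?p2 ?all_cat ?hu1 ?hu2.
Qed.

(** * Lie elements and primitive functions on words *)

(** The linear form F kills the shuffles of two nonempty words; equivalently, the
    series with coefficients F is primitive for the unshuffling coproduct. *)
Definition primitive (T : Type) (R : comNzRingType) (F : seq T -> R) : Prop :=
  F [::] = 0 /\ forall u v, ~~ nilp u -> ~~ nilp v -> \sum_(w <- shuffle u v) F w = 0.

Section Primitive.
Variables (T : Type) (R : comNzRingType).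
Implicit Types (F G : seq T -> R).

Lemma eq_primitive F G : F =1 G -> primitive F -> primitive G.
Proof.
move=> e [F0 FS]; split=> [|u v u0 v0]; first by rewrite -e.
by rewrite -[RHS](FS u v u0 v0); apply: eq_bigr => w _; rewrite e.
Qed.

Lemma primitiveD F G : primitive F -> primitive G -> primitive (fun w => F w + G w).
Proof.
move=> [F0 FS] [G0 GS]; split=> [|u v u0 v0]; first by rewrite F0 G0 addr0.
by rewrite big_split /= FS // GS // addr0.
Qed.

Lemma primitiveZ c F : primitive F -> primitive (fun w => c * F w).
Proof.
move=> [F0 FS]; split=> [|u v u0 v0]; first by rewrite F0 mulr0.
by rewrite -mulr_sumr FS // mulr0.
Qed.

Lemma primitive0 : primitive (fun=> 0 : R) (T := T).
Proof. by split=> // u v _ _; rewrite big1. Qed.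

Lemma primitive_sum (I : Type) (r : seq I) (P : pred I) (F : I -> seq T -> R) :
  (forall i, P i -> primitive (F i)) -> primitive (fun w => \sum_(i <- r | P i) F i w).
Proof.
move=> hF; elim: r => [|i r IH].
  by apply: eq_primitive primitive0 => w; rewrite big_nil.
case Pi: (P i); last by apply: eq_primitive IH => w; rewrite big_cons Pi.
by apply: eq_primitive (primitiveD (hF i Pi) IH) => w; rewrite big_cons Pi.
Qed.

Lemma primitive_map (S : Type) (f : S -> T) F :
  primitive F -> primitive (fun w => F (map f w)).
Proof.
move=> [F0 FS]; split=> // u v u0 v0.
rewrite -[LHS](big_map (map f) xpredT F) -shuffle_map.
by apply: FS; rewrite /nilp size_map.
Qed.

Lemma sum_shuffle_primitive F u v : primitive F ->
  \sum_(w <- shuffle u v) F w = (nilp u)%:R * F v + F u * (nilp v)%:R.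
Proof.
move=> [F0 FS]; case: u v => [|a u] [|b v].
- by rewrite big_seq1 F0 mulr0 mul0r addr0.
- by rewrite big_seq1 mulr0 addr0 mul1r.
- by rewrite shuffles0 big_seq1 mul0r add0r mulr1.
- by rewrite FS // mul0r mulr0 addr0.
Qed.

(** On shuffles of nonempty words the convolution of two primitive functions is
    symmetric in them; hence their bracket is primitive. *)
Lemma sum_shuffle_mul F G u v : primitive F -> primitive G ->
  ~~ nilp u -> ~~ nilp v ->
  \sum_(w <- shuffle u v) \sum_(x <- splits w) F x.1 * G x.2 = F u * G v + F v * G u.
Proof.
move=> pF pG /negbTE u0 /negbTE v0.
have z (w : seq T) : \sum_(x <- splits w) (nilp x.1)%:R * (nilp x.2)%:R = (nilp w)%:R :> R.
  exact: (sum_splits_nill w (fun w => (nilp w)%:R)).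
rewrite (sum_shuffle_splits u v (fun x y => F x * G y)).
transitivity (\sum_(x <- splits u) \sum_(y <- splits v)
   ((nilp x.1)%:R * (nilp x.2)%:R * (F y.1 * G y.2)
   + (nilp x.1)%:R * G x.2 * (F y.1 * (nilp y.2)%:R)
   + F x.1 * (nilp x.2)%:R * ((nilp y.1)%:R * G y.2)
   + F x.1 * G x.2 * ((nilp y.1)%:R * (nilp y.2)%:R))).
  apply: eq_bigr => x _; apply: eq_bigr => y _.
  by rewrite sum_shuffleM !sum_shuffle_primitive //; ring.
under eq_bigr do rewrite !big_split /=.
rewrite !big_split /= -!big_distrlr /= !z !sum_splits_nill !sum_splits_nilr u0 v0 /=.
by rewrite mul0r mulr0 addr0 add0r addrC [F v * _]mulrC.
Qed.

End Primitive.

(** Among the shuffles of u with a word that starts with a, only one has all the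
    letters of u before a. A primitive function is therefore determined by its
    values on the words that start with a. *)
Lemma primitive_head0 (T : eqType) (R : comNzRingType) (F : seq T -> R) a :
  primitive F -> (forall w, F (a :: w) = 0) -> forall u v, F (u ++ a :: v) = 0.
Proof.
move=> pF Fa u; have [N] := ubnP (size u); elim: N u => // N IH u lN v.
have [/nilP->|u0] := boolP (nilp u); first exact: Fa.
rewrite -[RHS](proj2 pF (a :: v) u isT u0) -[a :: v]cat0s sum_shuffle_pivot.
rewrite -(sum_splits_nilr u (fun x => F (x ++ [::] ++ a :: v))) big_seq [RHS]big_seq.
apply: eq_bigr => x /mem_splits e; rewrite shuffle0s big_seq1.
case: x.2 e => [|b x2] e; first by rewrite shuffles0 big_seq1 mulr1.
rewrite mulr0 big1 // => z _; apply: IH.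
by move: lN; rewrite e size_cat /= addnS !ltnS; apply: leq_trans; rewrite ltnS leq_addr.
Qed.

Section FreeAlgebra.
Variables (K : fieldType) (n : nat).
Implicit Types (w : seq 'I_n) (p q : free_alg K n).

Definition word_coef p w : K := p@_(FMonom w).

Lemma word_coefP p q : word_coef p =1 word_coef q -> p = q.
Proof. by move=> e; apply/malgP => -[w]; exact: e. Qed.

Lemma word_coefD p q w : word_coef (p + q) w = word_coef p w + word_coef q w.
Proof. exact: mcoeffD. Qed.

Lemma word_coefB p q w : word_coef (p - q) w = word_coef p w - word_coef q w.
Proof. exact: mcoeffB. Qed.

Lemma word_coefZ c p w : word_coef (c *: p) w = c * word_coef p w.
Proof. exact: mcoeffZ. Qed.

Lemma word_coef_sum (I : Type) (r : seq I) P (F : I -> free_alg K n) w :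
  word_coef (\sum_(i <- r | P i) F i) w = \sum_(i <- r | P i) word_coef (F i) w.
Proof. exact: raddf_sum. Qed.

Lemma FMonom_eq (u v : seq 'I_n) : (FMonom u == FMonom v) = (u == v).
Proof. by []. Qed.

Lemma word_coefU c u w : word_coef << c *g FMonom u >> w = c * (u == w)%:R.
Proof. by rewrite /word_coef mcoeffU FMonom_eq mulr_natr. Qed.

Lemma count_splits (u v w : seq 'I_n) :
  \sum_(x <- splits w) (u == x.1)%:R * (v == x.2)%:R = (u ++ v == w)%:R :> K.
Proof.
elim: w u => [|c w IH] u.
  by rewrite big_seq1 /=; case: u v => [|a u] [|b v]; rewrite ?mulr1 ?mul0r ?mulr0.
rewrite big_cons big_map; case: u => [|a u] /=.
  by rewrite mul1r big1 ?addr0 // => x _; rewrite mul0r.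
rewrite mul0r add0r eqseq_cons.
under eq_bigr do rewrite eqseq_cons -mulnb natrM -mulrA.
by rewrite -mulr_sumr IH -mulnb natrM.
Qed.

Lemma word_coefM p q w :
  word_coef (p * q) w = \sum_(x <- splits w) word_coef p x.1 * word_coef q x.2.
Proof.
have exp (r : free_alg K n) v :
    word_coef r v = \sum_(k <- msupp r) r@_k * (fmonom_val k == v)%:R.
  rewrite {1}(monalgE r) word_coef_sum; apply: eq_bigr => -[k] _.
  exact: word_coefU.
under eq_bigr do rewrite exp [word_coef q _]exp big_distrlr.
rewrite exchange_big /word_coef mcoeffMl; apply: eq_bigr => -[u] _ /=.
rewrite exchange_big; apply: eq_bigr => -[v] _ /=.
have -> : (mmul (FMonom u) (FMonom v) == FMonom w) = (u ++ v == w).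
  by rewrite [mmul _ _]fmmulE FMonom_eq.
by under [RHS]eq_bigr do rewrite mulrACA; rewrite -mulr_sumr count_splits mulr_natr.
Qed.

Lemma word_coef_var i w : word_coef (fvar K i) w = ([:: i] == w)%:R.
Proof. by rewrite /fvar fmuE word_coefU mul1r. Qed.

Lemma prod_fvar (s : 'I_n -> 'I_n) :
  \prod_(i < n) fvar K (s i) = << FMonom (map s (enum 'I_n)) >>.
Proof.
rewrite [index_enum _]unlock -enumT.
elim: (enum 'I_n) => [|i r IH]; first by rewrite big_nil -fmoneE.
rewrite big_cons IH /fvar malgM_def fgmulUU mul1r fmuE; congr (<< _ *g _ >>).
by rewrite [LHS]fmmulE.
Qed.

Lemma word_coef_mulvar p b w c :
  word_coef (p * fvar K b) (rcons w c) = word_coef p w * (b == c)%:R.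
Proof.
rewrite word_coefM -cats1.
rewrite (sum_splits_pivot w c [::] (fun x y => word_coef p x * word_coef (fvar K b) y)).
rewrite [X in _ + X]big_seq1 word_coef_var mulr0 addr0.
rewrite -(sum_splits_nilr w) mulr_suml; apply: eq_bigr => x _.
rewrite word_coef_var -mulrA; congr (_ * _).
by case: x.2 => [|a [|d v]]; rewrite /= ?mul1r ?mul0r ?eqseq_cons ?andbT ?andbF.
Qed.

Lemma word_coef_varmul p b w c :
  word_coef (fvar K b * p) (c :: w) = (b == c)%:R * word_coef p w.
Proof.
rewrite word_coefM big_cons big_map word_coef_var mul0r add0r.
rewrite -(sum_splits_nill w) mulr_sumr; apply: eq_bigr => x _.
rewrite word_coef_var mulrA eqseq_cons -mulnb natrM eq_sym; congr (_ * _ * _).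
by case: x.1.
Qed.

(** The left nested bracket of the letters of a word. *)
Definition lie_word a w : free_alg K n :=
  foldl (fun p b => p * fvar K b - fvar K b * p) (fvar K a) w.

Lemma lie_word_rcons a w b :
  lie_word a (rcons w b) = lie_word a w * fvar K b - fvar K b * lie_word a w.
Proof. by rewrite /lie_word foldl_rcons. Qed.

Lemma lie_word_Lie a w : Lie_element (lie_word a w).
Proof.
elim/last_ind: w => [|w b IH]; first exact: Lie_var.
by rewrite lie_word_rcons; apply: Lie_bracket => //; exact: Lie_var.
Qed.

(** A new letter b placed in front of the word, in the second term of the
    bracket, cannot be a. *)
Lemma lie_word_head a w w' : a \notin w ->
  word_coef (lie_word a w) (a :: w') = (w == w')%:R.
Proof.
elim/last_ind: w w' => [|w b IH] w' aw.
  by rewrite word_coef_var eqseq_cons eqxx.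
move: aw; rewrite mem_rcons inE negb_or => /andP[ab aw].
rewrite lie_word_rcons word_coefB word_coef_varmul eq_sym (negbTE ab) mul0r subr0.
case/lastP: w' => [|w' c].
  rewrite -[[:: a]]/(rcons [::] a) word_coef_mulvar eq_sym (negbTE ab) mulr0.
  by case: (w).
by rewrite -rcons_cons word_coef_mulvar IH // eqseq_rcons -mulnb natrM.
Qed.

Lemma lie_word_supp a w w' : word_coef (lie_word a w) w' != 0 -> perm_eq w' (a :: w).
Proof.
elim/last_ind: w w' => [|w b IH] w'.
  by rewrite word_coef_var; case: ([:: a] =P w') => [<-|_] //; rewrite eqxx.
have ins v : perm_eq v (a :: w) -> perm_eq (b :: v) (a :: rcons w b).
  move=> pv; rewrite -rcons_cons perm_sym -cats1 perm_catC /= perm_cons.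
  by rewrite perm_sym.
rewrite lie_word_rcons => nz.
have [h|h] := eqVneq (word_coef (fvar K b * lie_word a w) w') 0.
  move: nz; rewrite word_coefB h subr0.
  case/lastP: w' {h} => [|w' c].
    by rewrite word_coefM big_seq1 word_coef_var mulr0 eqxx.
  rewrite word_coef_mulvar; case: (b =P c) => [<-|_]; last by rewrite mulr0 eqxx.
  rewrite mulr1 => /IH /ins; apply: perm_trans.
  by rewrite -cats1 perm_catC.
case: w' h {nz} => [|c w'].
  by rewrite word_coefM big_seq1 word_coef_var mul0r eqxx.
rewrite word_coef_varmul; case: (b =P c) => [<-|_]; last by rewrite mul0r eqxx.
by rewrite mul1r => /IH /ins.
Qed.

(** The easy half of Friedrichs' theorem. *)
Lemma Lie_element_primitive p : Lie_element p -> primitive (word_coef p).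
Proof.
elim=> {p} [i||p q _ pp _ pq|c p _ pp|p q _ pp _ pq].
- split=> [|u v u0 v0]; first by rewrite word_coef_var.
  rewrite big_seq big1 // => w /mem_shuffle_perm/perm_size; rewrite size_cat word_coef_var.
  case: u v u0 v0 => [|a u] [|b v] //= _ _; rewrite addnS.
  by case: w => [|x [|y w]] //; rewrite eqseq_cons andbF.
- by apply: eq_primitive (primitive0 _ _) => w; rewrite /word_coef mcoeff0.
- by apply: eq_primitive (primitiveD pp pq) => w; rewrite word_coefD.
- by apply: eq_primitive (primitiveZ c pp) => w; rewrite word_coefZ.
- split=> [|u v u0 v0].
    by rewrite word_coefB !word_coefM !big_seq1 /= (proj1 pp) (proj1 pq) !mul0r subrr.
  under eq_bigr do rewrite word_coefB !word_coefM.
  by rewrite sumrB !sum_shuffle_mul //; ring.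
Qed.
End FreeAlgebra.

(** * Multilinear elements of the group ring *)

Definition perm_word n (s : 'S_n) : seq 'I_n := map s (enum 'I_n).

(** The coefficients of the multilinear element of the free algebra that
    corresponds to x. *)
Definition word_fun (R : comNzRingType) n (x : group_ring R n) (w : seq 'I_n) : R :=
  \sum_(s : 'S_n) x s * (perm_word s == w)%:R.

Lemma perm_word_inj n : injective (@perm_word n).
Proof.
move=> s t /eq_in_map e; apply/permP => i; apply: e; exact: mem_enum.
Qed.

Lemma perm_word_uniq n (s : 'S_n) : uniq (perm_word s).
Proof. by rewrite map_inj_uniq ?enum_uniq //; exact: perm_inj. Qed.

Lemma mem_perm_word n (s : 'S_n) i : i \in perm_word s.
Proof. by apply/mapP; exists (s^-1 i)%g; rewrite ?mem_enum // permKV. Qed.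

Lemma size_perm_word n (s : 'S_n) : size (perm_word s) = n.
Proof. by rewrite size_map size_enum_ord. Qed.

Lemma perm_wordP n (s : 'S_n) w :
  perm_eq w (perm_word s) -> exists t : 'S_n, w = perm_word t.
Proof.
move=> pw; have uw : uniq w by rewrite (perm_uniq pw) perm_word_uniq.
have sw : size w = n by rewrite (perm_size pw) size_perm_word.
case: n s w pw uw sw => [|n] s w pw uw sw.
  by exists s; case: w sw {pw uw} => // _; apply/esym/nilP; rewrite /nilp size_perm_word.
have inj : injective (fun i : 'I_n.+1 => nth ord0 w i).
  move=> i j e; apply/val_inj/eqP.
  by rewrite -(nth_uniq ord0 _ _ uw) ?sw ?ltn_ord ?e.
exists (perm inj); apply: (@eq_from_nth _ ord0); first by rewrite sw size_perm_word.
move=> i; rewrite sw => li; rewrite /perm_word.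
rewrite (nth_map ord0) ?size_enum_ord // permE.
by rewrite nth_enum_ord.
Qed.

Lemma word_fun_perm (R : comNzRingType) n (x : group_ring R n) s :
  word_fun x (perm_word s) = x s.
Proof.
rewrite /word_fun (bigD1 s) //= eqxx mulr1 big1 ?addr0 // => t ts.
by rewrite (inj_eq (@perm_word_inj n)) (negbTE ts) mulr0.
Qed.

Lemma word_fun_out (R : comNzRingType) n (x : group_ring R n) w :
  (forall s : 'S_n, perm_word s != w) -> word_fun x w = 0.
Proof. by move=> h; apply: big1 => s _; rewrite (negbTE (h s)) mulr0. Qed.

Lemma word_coef_to_free_alg (K : fieldType) n (x : group_ring K n) w :
  word_coef (to_free_alg x) w = word_fun x w.
Proof.
rewrite /to_free_alg word_coef_sum; apply: eq_bigr => s _.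
by rewrite word_coefZ prod_fvar word_coefU mul1r.
Qed.

Lemma gmulE (R : comNzRingType) n (x y : group_ring R n) g :
  gmul x y g = \sum_s x s * y (g * s^-1)%g.
Proof.
rewrite /gmul ffunE; apply: eq_bigr => s _; rewrite (big_pred1 (g * s^-1)%g) // => t.
by rewrite /= -(inj_eq (mulIg s^-1)%g) mulgK.
Qed.

Lemma perm_wordM n (s t : 'S_n) : perm_word (t * s)%g = map s (perm_word t).
Proof. by rewrite /perm_word -map_comp; apply: eq_map => i; rewrite /= permM. Qed.

Lemma word_fun_gmul (R : comNzRingType) n (x y : group_ring R n) w :
  word_fun (gmul x y) w = \sum_s x s * word_fun y (map s^-1%g w).
Proof.
rewrite /word_fun; under eq_bigr do rewrite gmulE mulr_suml.
rewrite exchange_big; apply: eq_bigr => s _ /=; rewrite mulr_sumr.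
rewrite (reindex_inj (mulIg s)) /=; apply: eq_bigr => t _.
rewrite mulgK mulrA.
have -> // : (perm_word (t * s)%g == w) = (perm_word t == map s^-1%g w).
apply/eqP/eqP => [<-|e].
  by rewrite perm_wordM -map_comp map_id_in // => i _; rewrite /= permK.
by rewrite perm_wordM e -map_comp map_id_in // => i _; rewrite /= permKV.
Qed.

(** Multiplication on the left renames the letters, and a renaming is compatible
    with shuffles. *)
Lemma primitive_gmul (R : comNzRingType) n (x y : group_ring R n) :
  primitive (word_fun y) -> primitive (word_fun (gmul x y)).
Proof.
move=> py; apply: (@eq_primitive _ _ (fun w => \sum_s x s * word_fun y (map s^-1%g w))).
  by move=> w; rewrite word_fun_gmul.
by apply: primitive_sum => s _; apply: primitiveZ; apply: primitive_map.
Qed.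

Section Friedrichs.
Variables (K : fieldType) (n : nat).
Implicit Types (y : group_ring K n.+1) (s : 'S_n.+1).

Definition lie_perm s : free_alg K n.+1 :=
  lie_word K (s ord0) (behead (perm_word s)).

Lemma perm_word_head s : perm_word s = s ord0 :: behead (perm_word s).
Proof. by rewrite /perm_word enum_ordSl. Qed.

Lemma lie_perm_supp s w : word_coef (lie_perm s) w != 0 -> perm_eq w (perm_word s).
Proof. by move/lie_word_supp; rewrite -perm_word_head. Qed.

Lemma lie_perm_head s w :
  word_coef (lie_perm s) (s ord0 :: w) = (perm_word s == s ord0 :: w)%:R.
Proof.
rewrite lie_word_head; first by rewrite [in RHS]perm_word_head eqseq_cons eqxx.
by have := perm_word_uniq s; rewrite perm_word_head => /andP[].
Qed.

(** Both sides are primitive and have the same values on the words that start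
    with a; they coincide by primitive_head0. *)
Lemma primitive_lie_expansion y a w : primitive (word_fun y) ->
  word_fun y w = \sum_(s : 'S_n.+1 | s ord0 == a) y s * word_coef (lie_perm s) w.
Proof.
move=> py; pose F w := word_fun y w
   + -1 * \sum_(s : 'S_n.+1 | s ord0 == a) y s * word_coef (lie_perm s) w.
have pF : primitive F.
  apply: primitiveD => //; apply: primitiveZ; apply: primitive_sum => s _.
  by apply: primitiveZ; apply: Lie_element_primitive; exact: lie_word_Lie.
suff : F w = 0 by move=> /eqP; rewrite /F mulN1r subr_eq0 => /eqP.
have Fa u : F (a :: u) = 0.
  rewrite /F mulN1r /word_fun [X in _ - X]big_mkcond -sumrB big1 // => s _.
  case: ifP => [/eqP <-|sa]; first by rewrite lie_perm_head subrr.
  by rewrite perm_word_head eqseq_cons sa mulr0 subrr.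
have [aw|aw] := boolP (a \in w); first by case/splitPr: aw => u v; exact: primitive_head0.
rewrite /F word_fun_out ?add0r; last first.
  by move=> s; apply: contraNneq aw => <-; exact: mem_perm_word.
rewrite big1 ?mulr0 // => s _.
have [->|/lie_perm_supp pw] := eqVneq (word_coef (lie_perm s) w) 0.
  by rewrite mulr0.
by move: aw; rewrite (perm_mem pw) mem_perm_word.
Qed.

(** Friedrichs' theorem for multilinear elements. *)
Lemma in_LieP y : in_Lie y <-> primitive (word_fun y).
Proof.
split=> [/Lie_element_primitive py|py].
  by apply: eq_primitive py => w; rewrite word_coef_to_free_alg.
rewrite /in_Lie.
have -> : to_free_alg y = \sum_(s : 'S_n.+1 | s ord0 == ord0) y s *: lie_perm s.
  apply: word_coefP => w; rewrite word_coef_to_free_alg (primitive_lie_expansion ord0 _ py).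
  by rewrite word_coef_sum; apply: eq_bigr => s _; rewrite word_coefZ.
apply: big_ind => [|p q|s _]; [exact: Lie_zero|exact: Lie_add|].
by apply: Lie_scale; exact: lie_word_Lie.
Qed.

End Friedrichs.

(** * Primitive functions and descent classes *)

Lemma eq_descent_letters (T : eqType) (f g : T -> nat) (a : seq T) :
  {in a &, forall x y, (f y < f x)%N = (g y < g x)%N} ->
  descent_letters (map f a) = descent_letters (map g a).
Proof.
case: a => // x a; elim: a x => //= y a IH x fg.
rewrite fg ?inE ?eqxx ?orbT //; congr (_ :: _); apply: IH => u v hu hv.
by apply: fg; rewrite inE ?hu ?hv orbT.
Qed.

Lemma index_filter_lt (T : eqType) (P : pred T) (w : seq T) x y : P x -> P y ->
  (index y (filter P w) < index x (filter P w))%N = (index y w < index x w)%N.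
Proof.
move=> Px Py; elim: w => //= c w IH.
case: ifP => Pc /=; first by case: (c == y); case: (c == x) => //=; rewrite !ltnS.
case: eqP => [e|_]; first by rewrite -e Pc in Py.
case: eqP => [e|_]; first by rewrite -e Pc in Px.
by rewrite ltnS.
Qed.

(** A word is a shuffle of its two restrictions to complementary sets of
    letters, in exactly one way. *)
Lemma sum_shuffle_filter (T : eqType) (R : comNzRingType) (P : pred T) (u v w : seq T) :
  all P u -> all (predC P) v ->
  \sum_(z <- shuffle u v) (w == z)%:R =
  (filter P w == u)%:R * (filter (predC P) w == v)%:R :> R.
Proof.
elim: w u v => [|c w IH] u v.
  case: u v => [|a u] [|b v] _ _; rewrite ?shuffle0s ?shuffles0 ?big_seq1 /= ?mul1r ?mul0r ?mulr1 //.
  by rewrite sum_shuffle_cons !big1 ?addr0.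
have cons0 (z : seq T) x : (c :: w == x :: z)%:R = (c == x)%:R * (w == z)%:R :> R.
  by rewrite eqseq_cons -mulnb natrM.
case: u v => [|a u] [|b v] /=.
- by rewrite shuffle0s big_seq1 /=; case: (P c) => /=; rewrite ?mul0r ?mulr0.
- move=> _ /andP[Pb Pv]; rewrite shuffle0s big_seq1 cons0.
  have := IH [::] v isT Pv; rewrite shuffle0s big_seq1 => ->.
  case: (boolP (P c)) => Pc /=.
    by rewrite mul0r; case: eqP Pb => [<-|]; rewrite ?Pc ?mul0r.
  by rewrite eqseq_cons -mulnb natrM mulrCA.
- move=> /andP[Pa Pu] _; rewrite shuffles0 big_seq1 cons0.
  have := IH u [::] Pu isT; rewrite shuffles0 big_seq1 => ->.
  case: (boolP (P c)) => Pc /=.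
    by rewrite eqseq_cons -mulnb natrM mulrA.
  by rewrite mulr0; case: eqP Pa => [<-|]; rewrite ?(negbTE Pc) ?mul0r.
move=> /andP[Pa Pu] /andP[Pb Pv]; rewrite sum_shuffle_cons.
under eq_bigr do rewrite cons0; rewrite -mulr_sumr IH //= ?Pb //.
under eq_bigr do rewrite cons0; rewrite -mulr_sumr IH //= ?Pa //.
case: (boolP (P c)) => Pc /=.
  rewrite eqseq_cons -mulnb natrM; case: (c =P b) Pb => [<-|_ _]; rewrite ?Pc //.
  by rewrite mul0r addr0 mulrA.
rewrite eqseq_cons -mulnb natrM; case: (c =P a) Pa => [<-|_ _]; first by rewrite (negbTE Pc).
by rewrite mul0r add0r mulrCA.
Qed.

Lemma size_descent_letters w : size (descent_letters w) = (size w).-1.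
Proof. by case: w => //= a w; rewrite size_pairmap. Qed.

Lemma descent_word_index n (g s : 'S_n) : descent_word (g * s^-1)%g =
  descent_letters (map (index^~ (perm_word s)) (perm_word g)).
Proof.
rewrite /descent_word [perm_word g]/perm_word -[in RHS]map_comp; congr descent_letters.
apply: eq_map => i /=.
have -> : index (g i) (perm_word s) = index (s ((g * s^-1)%g i)) (perm_word s).
  by rewrite permM permKV.
by rewrite index_map ?index_enum_ord //; exact: perm_inj.
Qed.

Lemma cut_word (T : Type) (w : seq T) i j : size w = (i + j).+2 ->
  exists A x b B, [/\ w = rcons A x ++ b :: B, size A = i & size B = j].
Proof.
elim: i w => [|i IH] [|a w] //= [].
  by case: w => //= b w [sw]; exists [::], a, b, w.
by move=> /IH[A [x [b [B [-> sA sB]]]]]; exists (a :: A), x, b, B; rewrite /= sA.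
Qed.

Section DescentClasses.
Variables (R : comNzRingType) (n : nat) (y : group_ring R n).
Hypothesis y_prim : primitive (word_fun y).

(** A function of the two restrictions of a word to complementary sets of letters
    is constant on sets of shuffles, so it pairs to 0 with a primitive function. *)
Lemma sum_restrictions (A B : seq 'I_n) (g : 'S_n) (Phi : seq 'I_n * seq 'I_n -> R) :
  perm_word g = A ++ B -> ~~ nilp A -> ~~ nilp B ->
  \sum_s y s * Phi (filter (mem A) (perm_word s), filter (predC (mem A)) (perm_word s)) = 0.
Proof.
move=> gAB A0 B0.
pose key s := (filter (mem A) (@perm_word n s),
               filter (predC (mem A)) (perm_word s)).
pose keys := undup (map key (index_enum 'S_n)).
transitivity (\sum_(k <- keys) Phi k * \sum_s y s * (key s == k)%:R).
  under [RHS]eq_bigr do rewrite mulr_sumr.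
  rewrite exchange_big; apply: eq_bigr => s _ /=.
  rewrite (bigD1_seq (key s)) ?undup_uniq ?mem_undup ?map_f ?mem_index_enum //=.
  rewrite eqxx mulr1 mulrC big1 ?addr0 // => k; rewrite eq_sym => /negbTE ->.
  by rewrite !mulr0.
rewrite big_seq big1 // => k; rewrite mem_undup => /mapP[t _ ->] {k}.
pose u := filter (mem A) (perm_word t); pose v := filter (predC (mem A)) (perm_word t).
rewrite -[key t]/(u, v).
have u0 : ~~ nilp u.
  case EA: A A0 => [|a A'] // _; rewrite /nilp size_filter -lt0n -has_count.
  by apply/hasP; exists a; rewrite ?mem_perm_word //= EA inE eqxx.
have v0 : ~~ nilp v.
  case EB: B B0 => [|b B'] // _; rewrite /nilp size_filter -lt0n -has_count.
  apply/hasP; exists b; rewrite ?mem_perm_word //=; apply/negP => bA.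
  have := perm_word_uniq g; rewrite gAB cat_uniq => /and3P[_ /hasPn/(_ b)].
  by rewrite EB inE eqxx bA => /(_ isT).
have -> : \sum_s y s * (key s == (u, v))%:R = \sum_(z <- shuffle u v) word_fun y z.
  rewrite exchange_big; apply: eq_bigr => s _; rewrite -mulr_sumr.
  rewrite (sum_shuffle_filter _ (P := mem A)) ?filter_all //.
  by rewrite -natrM mulnb.
by rewrite (proj2 y_prim) ?mulr0.
Qed.

Definition descent_sum (g : 'S_n) (e : seq letter) : R :=
  \sum_s y s * (descent_word (g * s^-1)%g == e)%:R.

(** The descent word of g s^-1 compares the positions in s of consecutive letters
    of g. If the comparison of the last letter of the first part of g with the
    next one is left free, the condition only bears on the two restrictions of
    s, whence sum_restrictions. *)
Lemma descent_sum_flip g e1 e2 : (size e1 + size e2).+2 = n ->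
  descent_sum g (e1 ++ lm :: e2) = - descent_sum g (e1 ++ lp :: e2).
Proof.
move=> sn; apply/eqP; rewrite -addr_eq0 /descent_sum -big_split /=.
have [A [x [b [B [gAB sA sB]]]]] : exists A x b B,
    [/\ perm_word g = rcons A x ++ b :: B, size A = size e1 & size B = size e2].
  by apply: cut_word; rewrite size_perm_word.
pose desc (a w : seq 'I_n) := descent_letters (map (index^~ w) a).
pose Phi (k : seq 'I_n * seq 'I_n) : R :=
  (desc (rcons A x) k.1 == e1)%:R * (desc (b :: B) k.2 == e2)%:R.
have AB0 : ~~ nilp (rcons A x) by case: (A).
apply/eqP; rewrite -[RHS](sum_restrictions (A := rcons A x) (B := b :: B) (g := g) Phi) //.
apply: eq_bigr => s _; rewrite -mulrDr; congr (_ * _).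
have uAB := perm_word_uniq g; rewrite gAB cat_uniq in uAB.
case/and3P: uAB => _ /hasPn BA _.
have d1 : desc (rcons A x) (filter (mem (rcons A x)) (perm_word s)) =
    desc (rcons A x) (perm_word s).
  by apply: eq_descent_letters => u v hu hv; rewrite index_filter_lt.
have d2 : desc (b :: B) (filter (predC (mem (rcons A x))) (perm_word s)) =
    desc (b :: B) (perm_word s).
  by apply: eq_descent_letters => u v /BA hu /BA hv; rewrite index_filter_lt.
rewrite /Phi d1 d2.
rewrite descent_word_index gAB map_cat map_rcons /= descent_letters_cat -map_rcons.
rewrite -/(desc _ _) -[descent_letters (_ :: map _ B)]/(desc (b :: B) (perm_word s)).
have sd : size (desc (rcons A x) (perm_word s)) = size e1.
  by rewrite size_descent_letters size_map size_rcons.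
rewrite !eqseq_cat // !eqseq_cons; case: (_ == e1); last by rewrite mul0r addr0.
by rewrite mul1r; case: (_ < _)%N; case: (_ == e2); rewrite /= ?addr0 ?add0r.
Qed.

Lemma descent_sum_sign g j e : (j + size e).+1 = n ->
  descent_sum g (nseq j lp ++ e) =
  (-1) ^+ count id e * descent_sum g (nseq (j + size e) lp).
Proof.
elim: e j => [|c e IH] j; first by rewrite addn0 cats0 expr0 mul1r.
have absorb : nseq j lp ++ lp :: e = nseq j.+1 lp ++ e.
  by rewrite -cat_rcons -[rcons _ _]cats1 -[[:: lp]]/(nseq 1 lp) -nseqD addn1.
rewrite /= addnS => sn; case: c => /=.
  rewrite descent_sum_flip ?size_nseq // absorb IH ?addSn //.
  by rewrite add0n exprS mulN1r mulNr.
by rewrite absorb IH ?addSn.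
Qed.

End DescentClasses.

Lemma descent_word_id n (s : 'S_n) j :
  (descent_word s == nseq j lp) = (s == 1%g) && (j == n.-1).
Proof.
have sz : size (descent_word s) = n.-1.
  by rewrite size_descent_letters size_map size_enum_ord.
have [->|jn] := eqVneq j n.-1; last first.
  by rewrite andbF; apply/negP => /eqP e; move: sz jn; rewrite e size_nseq => ->; rewrite eqxx.
have srt (l : seq nat) : (descent_letters l == nseq (size l).-1 lp) = sorted leq l.
  case: l => // a l; rewrite /= ; elim: l a => //= c l IH a.
  by rewrite eqseq_cons IH; case: ltnP.
have sm : size [seq val (s i) | i <- enum 'I_n] = n by rewrite size_map size_enum_ord.
rewrite andbT -{2}sm srt; apply/idP/eqP => [st|->].
  have p : perm_eq [seq val (s i) | i <- enum 'I_n] (iota 0 n).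
    rewrite -val_enum_ord (map_comp val s); apply: perm_map.
    apply: uniq_perm; [exact: perm_word_uniq|exact: enum_uniq|].
    by move=> i; rewrite mem_enum mem_perm_word.
  have e := sorted_eq leq_trans anti_leq st (iota_sorted _ _) p.
  apply/permP => i; rewrite perm1; apply/val_inj.
  have := congr1 (fun l => nth 0%N l i) e.
  by rewrite (nth_map i) ?size_enum_ord // nth_ord_enum nth_iota.
have -> : [seq val ((1%g : 'S_n) i) | i <- enum 'I_n] = iota 0 n.
  by rewrite -val_enum_ord; apply: eq_map => i; rewrite perm1.
exact: iota_sorted.
Qed.

(** Solomon's descent classes act on primitive elements by signs: a descent can
    be replaced by a rise at the cost of a sign (descent_sum_flip), and the
    identity is the only permutation without descents. *)
Lemma gmul_primitive (R : comNzRingType) n (d : seq letter -> R) : exists c : R,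
  forall y : group_ring R n.+1, primitive (word_fun y) ->
    gmul y [ffun s => d (descent_word s)] = gscale c y.
Proof.
exists (\sum_(e : n.-tuple letter) (-1) ^+ count id e * d e) => y py.
apply/ffunP => g; rewrite gmulE ffunE.
transitivity (\sum_(e : n.-tuple letter) d e * descent_sum y g e).
  under [RHS]eq_bigr do rewrite mulr_sumr.
  rewrite exchange_big; apply: eq_bigr => s _ /=; rewrite ffunE.
  have sz : size (descent_word (g * s^-1)%g) == n.
    by rewrite size_descent_letters size_map size_enum_ord.
  rewrite (bigD1 (Tuple sz)) //= eqxx mulr1 mulrC big1 ?addr0 // => e ne.
  case: eqP => [h|_]; last by rewrite !mulr0.
  by case/eqP: ne; apply: val_inj.
rewrite mulr_suml; apply: eq_bigr => e _.
have := @descent_sum_sign _ _ y py g 0 e; rewrite size_tuple => /(_ erefl) /= ->.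
rewrite mulrCA mulrA; congr (_ * _).
rewrite /descent_sum (bigD1 g) //= mulgV.
rewrite descent_word_id !eqxx mulr1 big1 ?addr0 // => s sg.
rewrite descent_word_id eqxx andbT; case: eqP => [h|_]; last by rewrite mulr0.
by case/eqP: sg; rewrite -[g](mulgKV s) h mul1g.
Qed.

(** * The eigenvalue of D *)

Section Eigenvalue.
Variables (K : fieldType) (n : nat).

Definition lie_elt (s : 'S_n.+1) : group_ring K n.+1 :=
  [ffun t : 'S_n.+1 => word_coef (lie_perm K s) (perm_word t)].

Lemma word_fun_lie_elt s : word_fun (lie_elt s) =1 word_coef (lie_perm K s).
Proof.
move=> w; have [e|nz] := eqVneq (word_coef (lie_perm K s) w) 0; last first.
  by have [t ->] := perm_wordP (lie_perm_supp nz); rewrite word_fun_perm ffunE.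
rewrite e; apply: big1 => t _; rewrite ffunE.
by case: eqP => [->|_]; rewrite ?e ?mul0r ?mulr0.
Qed.

Lemma primitive_lie_elt s : primitive (word_fun (lie_elt s)).
Proof.
apply: (@eq_primitive _ _ (word_coef (lie_perm K s))).
  by move=> w; rewrite word_fun_lie_elt.
by apply: Lie_element_primitive; exact: lie_word_Lie.
Qed.

Lemma lie_elt_id s : lie_elt s s = 1.
Proof. by rewrite ffunE {1}perm_word_head lie_perm_head -perm_word_head eqxx. Qed.

(** A trace computation. Let L_s be the bracket of the word s. On the one hand c
    is the coefficient of s in L_s theta; on the other hand, for each first letter
    a, the expansion of the translates of theta in the brackets of the words that
    start with a gives theta(1). Sum over s, and over a and the translations. *)
Lemma primitive_eigenvalue (theta : group_ring K n.+1) (c : K) :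
  (n.+1)`!%:R != 0 :> K -> primitive (word_fun theta) ->
  (forall y, primitive (word_fun y) -> gmul y theta = gscale c y) ->
  c = n.+1%:R * theta 1%g.
Proof.
move=> fact_neq0 ptheta theta_scalar; apply: (mulfI fact_neq0).
have cardS : (n.+1)`! = #|{: 'S_n.+1}| by rewrite card_Sn.
rewrite cardS !mulr_natl -!sumr_const.
transitivity (\sum_(s : 'S_n.+1) \sum_(g : 'S_n.+1) lie_elt s g * theta (s * g^-1)%g).
  apply: eq_bigr => s _; rewrite -gmulE theta_scalar; last exact: primitive_lie_elt.
  by rewrite ffunE lie_elt_id mulr1.
rewrite exchange_big; apply: eq_bigr => g _ /=.
pose y : group_ring K n.+1 := [ffun x => theta (x * g^-1)%g].
have py : primitive (word_fun y).
  have -> : y = gmul [ffun s => (s == g)%:R] theta.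
    apply/ffunP => x; rewrite gmulE ffunE (bigD1 g) //= ffunE eqxx mul1r.
    rewrite big1 ?addr0 // => s sg.
    by rewrite ffunE (negbTE sg) mul0r.
  exact: primitive_gmul.
rewrite (partition_big (fun s : 'S_n.+1 => s ord0) xpredT) //=.
transitivity (\sum_(a < n.+1) theta 1%g); last by rewrite sumr_const card_ord.
apply: eq_bigr => a _.
have := primitive_lie_expansion a (perm_word g) py.
rewrite word_fun_perm ffunE mulgV => ->; apply: eq_bigr => s _.
by rewrite !ffunE mulrC.
Qed.

End Eigenvalue.

Lemma natr_Kb_neq0 m : (m.+1%:R : Kb) != 0.
Proof.
rewrite -(rmorph_nat (@tofrac Qb)) tofrac_eq0.
by rewrite -polyC_natr polyC_eq0 pnatr_eq0.
Qed.

Lemma D_elt_primitive n : primitive (word_fun (extend_scalars (D_elt n.+1))).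
Proof.
set D := extend_scalars _.
have DE w : perm_eq w (perm_word (1%g : 'S_n.+1)) ->
    word_fun D w = tofrac (D_word (map val w)).
  move=> /perm_wordP[t ->]; rewrite word_fun_perm !ffunE d_coef_wt.
  have -> : descent_word t = descent_letters (map val (perm_word t)).
    by rewrite /descent_word /perm_word -[in RHS]map_comp.
  by rewrite perm_word_head.
have D0 w : ~~ perm_eq w (perm_word (1%g : 'S_n.+1)) -> word_fun D w = 0.
  move=> nw; apply: word_fun_out => s; apply: contraNneq nw => <-.
  apply: uniq_perm; rewrite ?perm_word_uniq // => i.
  by rewrite !mem_perm_word.
split=> [|u v u0 v0].
  by apply: D0; apply/negP => /perm_size; rewrite size_perm_word.
have [puv|npuv] := boolP (perm_eq (u ++ v) (perm_word (1%g : 'S_n.+1))); last first.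
  rewrite big_seq big1 // => w /mem_shuffle_perm pw; apply: D0.
  by apply: contraNN npuv; apply: perm_trans; rewrite perm_sym.
transitivity (tofrac (\sum_(w <- shuffle (map val u) (map val v)) D_word w)).
  rewrite rmorph_sum shuffle_map big_map big_seq [RHS]big_seq.
  apply: eq_bigr => w /mem_shuffle_perm pw.
  by rewrite DE // (perm_trans pw).
rewrite D_word_shuffle ?rmorph0 //.
- by case: (u) u0.
- by case: (v) v0.
by rewrite -map_cat (map_inj_uniq val_inj) (perm_uniq puv) perm_word_uniq.
Qed.

Lemma D_elt_id n : D_elt n.+1 1%g = ca n.
Proof.
have -> : D_elt n.+1 1%g = word_wt (nseq n lp).
  rewrite ffunE d_coef_wt; congr word_wt; apply/eqP.
  by rewrite descent_word_id !eqxx.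
have wtE j k : wt lp k (nseq j lp) = ca (k + j).
  by elim: j k => [|j IH] k; rewrite ?addn0 //= IH addnS addSn.
by case: n => [|n] //=; rewrite wtE add1n.
Qed.

(** The coefficient of the identity in D is the weight of a single block of rises,
    ca n; hence the scalar of the theorem. *)
Lemma gmul_D n (y : group_ring Kb n.+1) : primitive (word_fun y) ->
  gmul y (extend_scalars (D_elt n.+1)) = gscale (n.+1%:R * tofrac (ca n)) y.
Proof.
have [c hc] := @gmul_primitive Kb n (fun e => tofrac (d_coef e)).
have De : extend_scalars (D_elt n.+1) = [ffun s => tofrac (d_coef (descent_word s))].
  by apply/ffunP => s; rewrite !ffunE.
rewrite -De in hc; have nz : (n.+1)`!%:R != 0 :> Kb.
  by rewrite -(prednK (fact_gt0 n.+1)) natr_Kb_neq0.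
move=> py; rewrite hc // (primitive_eigenvalue nz (D_elt_primitive n) hc).
by rewrite [extend_scalars _ _]ffunE D_elt_id.
Qed.

Lemma extend_scalars_gmul n (x y : group_ring Qb n) :
  extend_scalars (gmul x y) = gmul (extend_scalars x) (extend_scalars y).
Proof.
apply/ffunP => g; rewrite ffunE !gmulE rmorph_sum; apply: eq_bigr => s _.
by rewrite !ffunE rmorphM.
Qed.

Lemma gmulZr (R : comNzRingType) n c (x y : group_ring R n) :
  gmul x (gscale c y) = gscale c (gmul x y).
Proof.
apply/ffunP => g; rewrite [RHS]ffunE !gmulE mulr_sumr; apply: eq_bigr => s _.
by rewrite ffunE mulrCA.
Qed.

Lemma gscaleA (R : comNzRingType) n c d (x : group_ring R n) :
  gscale c (gscale d x) = gscale (c * d) x.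
Proof. by apply/ffunP => g; rewrite !ffunE mulrA. Qed.

Lemma gscale1 (R : comNzRingType) n (x : group_ring R n) : gscale 1 x = x.
Proof. by apply/ffunP => g; rewrite !ffunE mul1r. Qed.

Theorem corollary6p5 (n : nat) (n_gt0 : (1 <= n)%N) :
  (exists2 c : Kb, c != 0 & Lie_idempotent (gscale c (extend_scalars (D_elt n))))
  /\ gmul (D_elt n) (D_elt n) = gscale (n%:R * ca n.-1) (D_elt n).
Proof.
case: n n_gt0 => // n _; set D := extend_scalars _.
have pD : primitive (word_fun D) := D_elt_primitive n.
set lam : Kb := n.+1%:R * tofrac (ca n).
have lam0 : lam != 0 by rewrite mulf_neq0 ?natr_Kb_neq0 // tofrac_eq0 ca_neq0.
have proj y : primitive (word_fun y) -> gmul y (gscale lam^-1 D) = y.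
  by move=> py; rewrite gmulZr gmul_D // gscaleA mulVf // gscale1.
have pscale c (y : group_ring Kb n.+1) :
    primitive (word_fun y) -> primitive (word_fun (gscale c y)).
  move=> py; apply: eq_primitive (primitiveZ c py) => w.
  by rewrite /word_fun mulr_sumr; apply: eq_bigr => s _; rewrite ffunE mulrA.
split.
  exists lam^-1; first by rewrite invr_eq0.
  split; first by apply: proj; apply: pscale.
  move=> y; split=> [/in_LieP py|[x ->]]; first by exists y; rewrite proj.
  by apply/in_LieP; apply: primitive_gmul; apply: pscale.
apply/ffunP => g; apply/eqP; rewrite -tofrac_eq; apply/eqP.
have := congr1 (fun x : group_ring Kb n.+1 => x g) (gmul_D pD).
rewrite -extend_scalars_gmul ffunE => ->.
by rewrite !ffunE rmorphM rmorphM rmorph_nat.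
Qed.
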